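(* Let $\Omega$ be a domain in $\mathbb C^n$. Suppose $f=u+iv$ is holomorphic on $\Omega$ (with $u,v$ real-valued), $|u|\le 1$ on $\Omega$, and $v(z_0)=0$ for some $z_0\in\Omega$. Then for any $\alpha>1$ there exists a constant $C_\alpha>0$ such that $$\int_{\partial\Omega_t}\frac{\exp\left(\frac{\pi}{2}|f|\right)}{(1+|f|)^\alpha}\,d\omega_{z_0,t}\le C_\alpha$$ holds for every $t$ and for any exhaustion $\{\Omega_t\}$ of $\Omega$ with $z_0\in\Omega_t$.
   Context: An exhaustion $\{\Omega_t\}$ of $\Omega$ is an increasing family of relatively compact subdomains of $\Omega$ whose union is $\Omega$. For such $\Omega_t\ni z_0$, $d\omega_{z_0,t}$ denotes the harmonic measure of $\Omega_t$ relative to $z_0$ (harmonicity with respect to the Euclidean Laplacian on $\mathbb C^n\cong\mathbb R^{2n}$). *)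

(* Defs.v *)
(* C^n is modelled as R^n x R^n = 'rV[R]_n * 'rV[R]_n,
   the point (x, y) standing for z = x + i y  (z_j = x_j + i y_j).
   The complex plane C is modelled as R * R, (a, b) standing for a + i b. *)
From mathcomp Require Import all_boot all_order all_algebra.
From mathcomp Require Import all_classical all_reals all_analysis.
Import numFieldNormedType.Exports.
Set Implicit Arguments. Unset Strict Implicit. Unset Printing Implicit Defensive.
Import Order.TTheory GRing.Theory Num.Theory.
Local Open Scope ring_scope.
Local Open Scope classical_set_scope.

Section Defs.
Variables (R : realType) (n : nat).

Notation V := ('rV[R]_n * 'rV[R]_n)%type.

Definition mulIn (w : V) : V := (- w.2, w.1).
Definition mulI1 (w : R * R) : R * R := (- w.2, w.1).

Definition holomorphic_on (D : set V) (f : V -> R * R) : Prop :=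
  forall z, D z -> differentiable f z /\
    forall w : V, 'd f z (mulIn w) = mulI1 ('d f z w).

Definition cmod (w : R * R) : R := Num.sqrt (w.1 ^+ 2 + w.2 ^+ 2).

Definition domain (D : set V) : Prop := open D /\ connected D /\ D !=set0.

Definition rel_compact (D O : set V) : Prop :=
  compact (closure D) /\ closure D `<=` O.

Definition boundary (D : set V) : set V := closure D `\` D.

Definition dirx (j : 'I_n) : V := (delta_mx ord0 j, 0).
Definition diry (j : 'I_n) : V := (0, delta_mx ord0 j).
Definition is_basis_dir (w : V) : Prop := exists j, w = dirx j \/ w = diry j.

Definition C2_on (D : set V) (h : V -> R) : Prop :=
  (forall z, D z -> {for z, continuous h}) /\
  forall v w, is_basis_dir v -> is_basis_dir w ->
    forall z, D z ->
      [/\ derivable h z v, derivable ('D_v h) z w,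
          {for z, continuous ('D_v h)} &
          {for z, continuous ('D_w ('D_v h))}].

Definition laplacian (h : V -> R) (z : V) : R :=
  \sum_(j < n) ('D_(dirx j) ('D_(dirx j) h) z + 'D_(diry j) ('D_(diry j) h) z).

Definition harmonic_on (D : set V) (h : V -> R) : Prop :=
  open D /\ C2_on D h /\ forall z, D z -> laplacian h z = 0.

(* Subharmonic functions on an open set D (F. Riesz's definition):
   values in [-oo, +oo), upper semicontinuous on D, and dominated by every
   harmonic majorant on relatively compact open subsets of D. *)
Definition subharmonic_on (D : set V) (s : V -> \bar R) : Prop :=
  [/\ forall z, D z -> (s z < +oo)%E,
      forall z, D z -> forall c : R, (s z < c%:E)%E ->
        \forall y \near z, (s y < c%:E)%E &
      forall (G : set V) (h : V -> R), open G -> rel_compact G D ->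
        {within closure G, continuous h} -> harmonic_on G h ->
        (forall p, boundary G p -> (s p <= (h p)%:E)%E) ->
        forall z, G z -> (s z <= (h z)%:E)%E].

Definition perron_class (D : set V) (g : V -> R) : set (V -> \bar R) :=
  [set s | subharmonic_on D s /\
     forall p, boundary D p -> forall e : R, 0 < e ->
       \forall z \near p, D z -> (s z <= (g p + e)%:E)%E].

(* Integral of g (continuous near the boundary) against the harmonic measure
   of D relative to z0:  int_{bd D} g d omega_{z0} = H_g(z0), the
   Perron(-Wiener) solution of the Dirichlet problem with data g at z0. *)
Definition harm_measure_integral (D : set V) (z0 : V) (g : V -> R) : \bar R :=
  ereal_sup [set s z0 | s in perron_class D g].

End Defs.

(* Main.v *)
Require Import Defs.
From mathcomp Require Import all_boot all_order all_algebra.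
From mathcomp Require Import all_classical all_reals all_analysis.
From mathcomp Require Import ring lra zify.
Import numFieldNormedType.Exports.
Import Order.TTheory GRing.Theory Num.Theory.
Local Open Scope ring_scope.
Local Open Scope classical_set_scope.

(** On the strip |x| <= 1, the function
      S(x, y) = sum_k q^k cosh (l_k y) cos (l_k x),
    with l_k = (1 - 2^-k) pi/2 and q = 2^(1 - alpha), is nonnegative, and so are
    its partial sums; these are the real parts of the entire functions
    sum_(k < N) q^k cos (l_k (x + i y)).  If 2^k is comparable to 1 + |y|, the k-th
    term alone is at least a constant times exp (pi/2 |y|) / (1 + |y|)^alpha,
    because cos (l_k x) >= sin (2^-k pi/2) >= 2^-k.  On a compact subset of Om the
    function v is bounded, so a partial sum dominates the integrand up to a
    constant, while S(u(z0), 0) <= 1 / (1 - q) whatever the number of terms.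

    It remains to compare a subharmonic function with H = S_N(u, v), which is the
    real part of a function that is only known to be complex differentiable.
    Averages of H over small segments, taken twice in each coordinate direction,
    are of class C^2: each derivative of an average is a difference quotient.
    They are harmonic since Goursat's theorem on squares is a discrete
    Cauchy-Riemann equation between difference quotients of averages, and they
    converge to H uniformly on compact sets. *)

(** * Primitives and integrals of continuous functions *)

Section PrimitivesOnR.
Set Implicit Arguments. Unset Strict Implicit. Unset Printing Implicit Defensive.
Context {R : realType}.
Implicit Types f g F G : R -> R.

Definition primitive f F := forall x : R, is_derive x 1 F (f x).

Lemma primitive_continuous f F : primitive f F -> continuous F.
Proof.
move=> fF x; apply/differentiable_continuous/derivable1_diffP.
by have [] := fF x.
Qed.

Lemma primitive_MVT f F (a b : R) : primitive f F -> a <= b ->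
  exists2 c, c \in `[a, b]%R & F b - F a = f c * (b - a).
Proof.
move=> fF ab; apply: (@MVT_segment R F f a b) => //.
by apply: continuous_subspaceT; exact: primitive_continuous fF.
Qed.

Lemma primitive_bound f F (a b e : R) : primitive f F -> a <= b ->
  (forall x, a <= x <= b -> `|f x| <= e) -> `|F b - F a| <= e * (b - a).
Proof.
move=> fF ab fe; have [c cab ->] := primitive_MVT fF ab.
rewrite normrM [`|b - a|]ger0_norm ?subr_ge0//.
by apply: ler_wpM2r; rewrite ?subr_ge0//; apply: fe; move: cab; rewrite in_itv.
Qed.

Lemma primitive_cst (c : R) : primitive (fun=> c) (fun x => c * x).
Proof.
move=> x; have := is_deriveZ c (is_derive_id x (1 : R)).
by rewrite [_ *: _]mulr1.
Qed.

Lemma primitiveD f g F G :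
  primitive f F -> primitive g G -> primitive (f \+ g) (F \+ G).
Proof. by move=> fF gG x; apply: is_deriveD. Qed.

Lemma primitiveB f g F G :
  primitive f F -> primitive g G -> primitive (f \- g) (F \- G).
Proof. by move=> fF gG x; apply: is_deriveB. Qed.

Lemma primitive_shift f F (s : R) :
  primitive f F -> primitive (fun x => f (s + x)) (fun x => F (s + x)).
Proof.
move=> fF x; have d1 : is_derive x (1 : R) (cst s \+ id) (0 + 1).
  exact: is_deriveD.
have := is_derive1_comp (fF (s + x)) d1.
by rewrite add0r mulr1.
Qed.

(** The difference [F - G] has zero derivative, so the mean value theorem makes it constant. The
    hypotheses are restricted to an open interval because the integrals glued together in
    [primitive_exists] have the right derivative only to the right of their base point. *)
Lemma primitive_unique_itv f F G (a b x y : R) :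
  (forall z, z \in `]a, b[%R -> is_derive z 1 F (f z)) ->
  (forall z, z \in `]a, b[%R -> is_derive z 1 G (f z)) ->
  x \in `]a, b[%R -> y \in `]a, b[%R -> F y - F x = G y - G x.
Proof.
move=> fF fG xab yab; wlog xy : x y xab yab / x <= y.
  move=> H; have [/H|/ltW /H] := leP x y; first exact.
  by move=> /(_ yab xab) ?; lra.
have sub z : z \in `[x, y]%R -> z \in `]a, b[%R.
  move: xab yab; rewrite !in_itv/= => /andP[ax _] /andP[_ yb] /andP[xz zy].
  by rewrite (lt_le_trans ax xz) (le_lt_trans zy yb).
have dFG z : z \in `]a, b[%R -> is_derive z 1 (F \- G) 0.
  move=> zab; rewrite -(subrr (f z)).
  by apply: is_deriveB; [exact: fF|exact: fG].
have cFG : {within `[x, y], continuous (F \- G)}.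
  apply: derivable_within_continuous => z /sub zab.
  by have [] := dFG z zab.
have dFG' z : z \in `]x, y[%R -> is_derive z 1 (F \- G) 0.
  by move=> zxy; apply/dFG/sub/subset_itv_oo_cc.
have [c _ E] := @MVT_segment R (F \- G) (fun=> 0) x y xy dFG' cFG.
by move: E; rewrite mul0r /= => E; lra.
Qed.

Lemma primitive_unique f F G (a b : R) :
  primitive f F -> primitive f G -> F b - F a = G b - G a.
Proof.
move=> fF fG.
apply: (@primitive_unique_itv f F G (Num.min a b - 1) (Num.max a b + 1)) => //.
- by rewrite in_itv/=; have [] := leP a b => ?; apply/andP; split; lra.
- by rewrite in_itv/=; have [] := leP a b => ?; apply/andP; split; lra.
Qed.

(** The integral from [- M] is differentiable only beyond [- M], so the base point has to move with
    [x]. Subtracting the value at 0 makes the different choices agree. *)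
Lemma primitive_exists f : continuous f -> exists F, primitive f F.
Proof.
move=> cf.
pose H M x := \int[lebesgue_measure]_(t in `[- M, x]) f t.
have HD (M x : R) : - M < x -> is_derive x 1 (H M) (f x).
  move=> Mx.
  have fi : lebesgue_measure.-integrable `[- M, x + 1] (EFin \o f).
    apply: continuous_compact_integrable; first exact: segment_compact.
    exact: continuous_subspaceT.
  have x1 : x < x + 1 by lra.
  have [d1 d2] := continuous_FTC1_closed x1 fi Mx (cf x).
  by apply: DeriveDef; [exact: d1|rewrite -derive1E; exact: d2].
pose F x := H (`|x| + 1) x - H (`|x| + 1) 0.
exists F => x.
(* For [y] within 1 of [x], this fixed base point lies to the left of the moving one [- (|y| + 1)].
   Both integrals are then primitives on an interval that contains 0 and [y]. *)
pose M := `|x| + 2.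
have dH : is_derive x 1 (fun y => H M y - H M 0) (f x).
  rewrite -[f x]subr0; apply: is_deriveB; apply: HD.
  by rewrite /M; have := ler_norm (- x); rewrite normrN => ?; lra.
apply: (near_eq_is_derive _ dH).
near=> y; rewrite /F.
have yx : `|y| < `|x| + 1.
  have : `|y - x| < 1 by near: y; apply: cvgr_distC_lt; [exact: cvg_id|].
  have := ler_normD (y - x) x; rewrite subrK => ? ?; lra.
apply: (@primitive_unique_itv f _ _ (- (`|y| + 1)) (`|y| + 1)).
- move=> z; rewrite in_itv/= => /andP[z1 z2]; apply: HD.
  by rewrite /M; lra.
- by move=> z; rewrite in_itv/= => /andP[z1 z2]; apply: HD.
- by rewrite in_itv/=; have := normr_ge0 y => ?; apply/andP; split; lra.
- rewrite in_itv/=; have := ler_norm (- y); have := ler_norm y; rewrite normrN.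
  by move=> ? ?; apply/andP; split; lra.
Unshelve. all: by end_near. Qed.

(** A criterion without division, suited to remainders that are estimated by integration. *)
Lemma is_derive_intro f (x l : R) :
  (forall e, 0 < e -> \forall y \near (0 : R),
     `|f (x + y) - f x - y * l| <= e * `|y|) -> is_derive x 1 f l.
Proof.
move=> H.
have cv : (fun h => h^-1 *: (f (h *: 1 + x) - f x)) @ 0^' --> l.
  apply/cvgrPdist_le => e e0; near=> h.
  have h0 : h != 0 by near: h; exact: nbhs_dnbhs_neq.
  have : `|f (x + h) - f x - h * l| <= e * `|h|.
    by near: h; apply: nbhs_dnbhs; exact: H.
  have -> : l - h^-1 *: (f (h *: 1 + x) - f x) =
      - ((f (x + h) - f x - h * l) / h).
    by rewrite [h *: 1]mulr1 (addrC h) [_ *: _]mulrC; field.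
  rewrite normrN.
  by rewrite normrM normfV ler_pdivrMr ?normr_gt0.
apply: DeriveDef; first by apply/cvg_ex; exists l.
exact: cvg_lim cv.
Unshelve. all: by end_near. Qed.

(** The oriented integral of [f] from 0 to [d], read off a chosen primitive. Any primitive gives the
    same value; the definition is meaningful as soon as one exists, in particular for continuous
    [f]. *)
Definition integ f (d : R) : R :=
  let F := get [set F | primitive f F] in F d - F 0.

Lemma integE f F (d : R) : primitive f F -> integ f d = F d - F 0.
Proof.
move=> fF; apply: primitive_unique (fF).
exact: (getI (P := [set F | primitive f F]) fF).
Qed.

Lemma integ_bound f (d e : R) : continuous f -> 0 <= d ->
  (forall x, 0 <= x <= d -> `|f x| <= e) -> `|integ f d| <= e * d.
Proof.
move=> /primitive_exists[F fF] d0 fe; rewrite (integE d fF).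
by have := primitive_bound fF d0 fe; rewrite subr0.
Qed.

Lemma integ_cst (c d : R) : integ (fun=> c) d = c * d.
Proof. by rewrite (integE _ (primitive_cst c)) mulr0 subr0. Qed.

Lemma integB f g d : continuous f -> continuous g ->
  integ (fun x => f x - g x) d = integ f d - integ g d.
Proof.
move=> /primitive_exists[F fF] /primitive_exists[G gG].
rewrite (integE _ fF) (integE _ gG) (integE _ (primitiveB fF gG)) /=.
by ring.
Qed.

End PrimitivesOnR.

(** * Goursat's theorem on squares *)

Section Goursat.
Set Implicit Arguments. Unset Strict Implicit. Unset Printing Implicit Defensive.
Context {R : realType}.

Lemma nested_intervals (x l : nat -> R) :
  (forall k, x k <= x k.+1) -> (forall k, x k.+1 + l k.+1 <= x k + l k) ->
  (forall k, 0 <= l k) -> exists p, forall k, x k <= p <= x k + l k.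
Proof.
move=> xS lS l0.
have xm : {homo x : i j / (i <= j)%N >-> i <= j}.
  by apply: homo_leq => // ? ? ?; exact: le_trans.
have lm i j : (i <= j)%N -> x j + l j <= x i + l i.
  elim: j => [|j IH]; first by rewrite leqn0 => /eqP ->.
  rewrite leq_eqVlt => /predU1P[->//|/IH]; exact: le_trans.
have ub i j : x i <= x j + l j.
  have [ij|/ltnW ji] := leqP i j.
    by rewrite (le_trans (xm _ _ ij))// lerDl.
  by apply: le_trans (lm _ _ ji); rewrite lerDl.
exists (sup (range x)) => k; apply/andP; split.
  by apply: ub_le_sup; [exists (x 0%N + l 0%N) => _ [i _ <-]|exists k].
by apply: ge_sup; [exists (x k); exists k|move=> _ [i _ <-]].
Qed.

Lemma exp2_gt (x : R) : exists k, x < 2 ^+ k.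
Proof.
exists (Num.bound `|x|); apply: le_lt_trans (ler_norm x) _.
apply: lt_trans (archi_boundP (normr_ge0 x)) _.
by rewrite -natrX ltr_nat ltn_expl.
Qed.

(** Bisection: [Bad a b s] speaks of the square with lower left corner [(a, b)] and side [s].
    Passing repeatedly to a bad quarter yields nested squares that shrink to the point
    [(a0, b0)]. *)
Lemma nested_squares (Bad : R -> R -> R -> Prop) (d : R) : 0 < d -> Bad 0 0 d ->
  (forall a b s, Bad a b s ->
     exists a' b', [/\ a' = a \/ a' = a + s / 2, b' = b \/ b' = b + s / 2 &
                       Bad a' b' (s / 2)]) ->
  exists a0 b0, [/\ 0 <= a0 <= d, 0 <= b0 <= d &
    forall r, 0 < r -> exists a b s,
      [/\ 0 < s <= r, a <= a0 <= a + s, b <= b0 <= b + s & Bad a b s]].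
Proof.
move=> d0 bad0 badS.
(* The choice function must be total; [(0, 0)] is a dummy value on squares that are not bad. *)
have /choice[F HF] : forall ps : (R * R) * R, exists p : R * R,
    Bad ps.1.1 ps.1.2 ps.2 ->
    [/\ p.1 = ps.1.1 \/ p.1 = ps.1.1 + ps.2 / 2,
        p.2 = ps.1.2 \/ p.2 = ps.1.2 + ps.2 / 2 &
        Bad p.1 p.2 (ps.2 / 2)].
  move=> [[a b] s] /=.
  have [/badS[a' [b' H]]|nB] := pselect (Bad a b s); first by exists (a', b').
  by exists (0, 0).
pose l k : R := d / 2 ^+ k.
have lS k : l k.+1 = l k / 2 by rewrite /l exprSr invfM mulrA.
have l0 k : 0 < l k by rewrite /l divr_gt0// exprn_gt0.
pose u := fix u k := if k is k'.+1 then F (u k', l k') else (0, 0).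
have uB k : Bad (u k).1 (u k).2 (l k).
  elim: k => [|k IH]; first by rewrite /l expr0 divr1.
  by rewrite lS /=; have [_ _] := HF (u k, l k) IH.
have u1 k : (u k.+1).1 = (u k).1 \/ (u k.+1).1 = (u k).1 + l k / 2.
  by have [] := HF (u k, l k) (uB k).
have u2 k : (u k.+1).2 = (u k).2 \/ (u k.+1).2 = (u k).2 + l k / 2.
  by have [] := HF (u k, l k) (uB k).
have [||k|a0 Ha] := @nested_intervals (fun k => (u k).1) l.
- by move=> k; have := l0 k; case: (u1 k) => -> ?; lra.
- by move=> k; rewrite lS; have := l0 k; case: (u1 k) => -> ?; lra.
- exact: ltW.
have [||k|b0 Hb] := @nested_intervals (fun k => (u k).2) l.
- by move=> k; have := l0 k; case: (u2 k) => -> ?; lra.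
- by move=> k; rewrite lS; have := l0 k; case: (u2 k) => -> ?; lra.
- exact: ltW.
exists a0, b0; split.
- by have := Ha 0%N; rewrite /l expr0 divr1 add0r.
- by have := Hb 0%N; rewrite /l expr0 divr1 add0r.
move=> r r0; have [k kr] := exp2_gt (d / r).
exists (u k).1, (u k).2, (l k); split => //.
rewrite l0 /l ler_pdivrMr ?exprn_gt0// mulrC -ler_pdivrMr//.
exact: ltW.
Qed.

(** The shared coefficient [pb] says that the form P da + Q db is closed at each point of the
    square, with no continuity of the derivatives. A nonzero circulation would stay at least
    [c * s ^+ 2] on ever smaller squares, against the first order expansion at their common
    point. *)
Lemma goursat_square (P Q : R -> R -> R) (d : R) : 0 < d ->
  (forall b, continuous (P ^~ b)) -> (forall a, continuous (Q a)) ->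
  (forall a b, 0 <= a <= d -> 0 <= b <= d -> exists pa pb qb : R,
    forall e, 0 < e -> exists2 r, 0 < r & forall a' b',
      `|a' - a| <= r -> `|b' - b| <= r ->
      `|P a' b' - P a b - (pa * (a' - a) + pb * (b' - b))|
        <= e * (`|a' - a| + `|b' - b|) /\
      `|Q a' b' - Q a b - (pb * (a' - a) + qb * (b' - b))|
        <= e * (`|a' - a| + `|b' - b|)) ->
  integ (fun t => P t d - P t 0) d = integ (fun t => Q d t - Q 0 t) d.
Proof.
move=> d0 cP cQ PQ.
have [PI HP] := choice (fun b => primitive_exists (cP b)).
have [QI HQ] := choice (fun a => primitive_exists (cQ a)).
(* Circulation of P da + Q db, counterclockwise around the square of side [s] at [(a, b)]. In [J4]
   the contributions of the inner edges cancel. *)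
pose J a b s := ((PI b (a + s) - PI b a) - (PI (b + s) (a + s) - PI (b + s) a))
  + ((QI (a + s) (b + s) - QI (a + s) b) - (QI a (b + s) - QI a b)).
have J4 a b s : J a b s = J a b (s / 2) + J (a + s / 2) b (s / 2) +
    J a (b + s / 2) (s / 2) + J (a + s / 2) (b + s / 2) (s / 2).
  rewrite /J.
  have E x : x + s / 2 + s / 2 = x + s by lra.
  by rewrite !E; ring.
have Jloc a0 b0 : 0 <= a0 <= d -> 0 <= b0 <= d -> forall e, 0 < e ->
    exists2 r, 0 < r & forall a b s, 0 < s <= r -> a <= a0 <= a + s ->
      b <= b0 <= b + s -> `|J a b s| <= 8 * e * s ^+ 2.
  move=> a0d b0d e e0.
  have [pa [pb [qb /(_ e e0)[r r0 H]]]] := PQ a0 b0 a0d b0d.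
  exists r => // a b s /andP[s0 sr] /andP[aa0 a0s] /andP[bb0 b0s].
  have near_s x y y' : x <= y <= x + s -> x <= y' <= x + s -> `|y' - y| <= s.
    by move=> /andP[? ?] /andP[? ?]; rewrite ler_norml; apply/andP; split; lra.
  have err a' b' : a <= a' <= a + s -> b <= b' <= b + s ->
      `|P a' b' - P a0 b0 - (pa * (a' - a0) + pb * (b' - b0))| <= 2 * e * s /\
      `|Q a' b' - Q a0 b0 - (pb * (a' - a0) + qb * (b' - b0))| <= 2 * e * s.
    move=> aa' bb'.
    have ha : `|a' - a0| <= s by apply: (near_s a); rewrite ?aa0.
    have hb : `|b' - b0| <= s by apply: (near_s b); rewrite ?bb0.
    have [H1 H2] := H a' b' (le_trans ha sr) (le_trans hb sr).
    have le : e * (`|a' - a0| + `|b' - b0|) <= 2 * e * s by nra.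
    by split; [exact: le_trans H1 le|exact: le_trans H2 le].
  have ends x : x <= x <= x + s /\ x <= x + s <= x + s.
    by split; apply/andP; split; lra.
  have [[aI asI] [bI bsI]] := (ends a, ends b).
  (* The affine part contributes [- pb * s ^+ 2] through the horizontal edges and [pb * s ^+ 2]
     through the vertical ones, so only the errors survive in [J]. *)
  have A : `|(PI b (a + s) - PI b a) - (PI (b + s) (a + s) - PI (b + s) a)
      + pb * s ^+ 2| <= 4 * e * s ^+ 2.
    have prim : primitive (fun t => P t b - P t (b + s) + pb * s)
        (fun t => PI b t - PI (b + s) t + pb * s * t).
      by apply: primitiveD; [exact: primitiveB|exact: primitive_cst].
    have as_ : a <= a + s by lra.
    have := primitive_bound (e := 4 * e * s) prim as_.
    have -> : a + s - a = s by ring.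
    have -> : 4 * e * s * s = 4 * e * s ^+ 2 by ring.
    set X := (X in _ -> `|X| <= _); set Y := (Y in `|Y| <= _).
    have -> : Y = X by rewrite /X /Y; ring.
    apply => t tas.
    have [e1 _] := err t b tas bI; have [e2 _] := err t (b + s) tas bsI.
    move: e1 e2; rewrite !ler_norml => /andP[? ?] /andP[? ?].
    by apply/andP; split; lra.
  have B : `|(QI (a + s) (b + s) - QI (a + s) b) - (QI a (b + s) - QI a b)
      - pb * s ^+ 2| <= 4 * e * s ^+ 2.
    have prim : primitive (fun t => Q (a + s) t - Q a t - pb * s)
        (fun t => QI (a + s) t - QI a t - pb * s * t).
      by apply: primitiveB; [exact: primitiveB|exact: primitive_cst].
    have bs_ : b <= b + s by lra.
    have := primitive_bound (e := 4 * e * s) prim bs_.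
    have -> : b + s - b = s by ring.
    have -> : 4 * e * s * s = 4 * e * s ^+ 2 by ring.
    set X := (X in _ -> `|X| <= _); set Y := (Y in `|Y| <= _).
    have -> : Y = X by rewrite /X /Y; ring.
    apply => t tbs.
    have [_ e1] := err a t aI tbs; have [_ e2] := err (a + s) t asI tbs.
    move: e1 e2; rewrite !ler_norml => /andP[? ?] /andP[? ?].
    by apply/andP; split; lra.
  move: A B; rewrite /J !ler_norml => /andP[? ?] /andP[? ?].
  by apply/andP; split; lra.
have J0 : J 0 0 d = 0.
  apply/eqP/negP => /negP Jn0.
  pose c := `|J 0 0 d| / d ^+ 2.
  have c0 : 0 < c by rewrite divr_gt0 ?normr_gt0// exprn_gt0.
  have [||a b s Bs|a0 [b0 [a0d b0d H]]] :=
    @nested_squares (fun a b s => c * s ^+ 2 <= `|J a b s|) d.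
  - by [].
  - by rewrite /c divfK// expf_eq0/= gt_eqF.
  - have [//|n1] := leP (c * (s / 2) ^+ 2) `|J a b (s / 2)|.
      by exists a, b; split => //; left.
    have [//|n2] := leP (c * (s / 2) ^+ 2) `|J (a + s / 2) b (s / 2)|.
      by exists (a + s / 2), b; split => //; [right|left].
    have [//|n3] := leP (c * (s / 2) ^+ 2) `|J a (b + s / 2) (s / 2)|.
      by exists a, (b + s / 2); split => //; [left|right].
    have [//|n4] := leP (c * (s / 2) ^+ 2) `|J (a + s / 2) (b + s / 2) (s / 2)|.
      by exists (a + s / 2), (b + s / 2); split => //; right.
    exfalso; move: Bs; rewrite J4 leNgt => /negP; apply.
    have -> : c * s ^+ 2 = c * (s / 2) ^+ 2 + c * (s / 2) ^+ 2 +
      c * (s / 2) ^+ 2 + c * (s / 2) ^+ 2 by field.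
    apply: le_lt_trans (ler_normD _ _) _; apply: ltrD => //.
    apply: le_lt_trans (ler_normD _ _) _; apply: ltrD => //.
    by apply: le_lt_trans (ler_normD _ _) _; exact: ltrD.
  (* With this tolerance the local bound is half of [c * s ^+ 2], which contradicts badness. *)
  have c16 : 0 < c / 16 by rewrite divr_gt0.
  have [r r0 Hr] := Jloc a0 b0 a0d b0d _ c16.
  have [a [b [s [sr ha hb]]]] := H r r0.
  rewrite leNgt => /negP; apply.
  apply: le_lt_trans (Hr a b s sr ha hb) _.
  have s0 : 0 < s by case/andP: sr.
  have : 0 < c * s ^+ 2 by rewrite mulr_gt0// exprn_gt0.
  by lra.
have prP : primitive (fun t => P t d - P t 0) (fun t => PI d t - PI 0 t).
  exact: primitiveB.
have prQ : primitive (fun t => Q d t - Q 0 t) (fun t => QI d t - QI 0 t).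
  exact: primitiveB.
rewrite (integE d prP) (integE d prQ).
by move: J0; rewrite /J !add0r; lra.
Qed.

End Goursat.

(** * Averages over segments *)

Section Averages.
Set Implicit Arguments. Unset Strict Implicit. Unset Printing Implicit Defensive.
Context {R : realType} {V : normedModType R}.
Implicit Types (f g h : V -> R) (v w z : V) (d e s : R).

Lemma line_continuous h z w : continuous h -> continuous (fun t : R => h (z + t *: w)).
Proof.
move=> ch t; apply: continuous_comp; last exact: ch.
by apply: cvgD; [exact: cvg_cst|apply: cvgZr_tmp; exact: cvg_id].
Qed.

Arguments line_continuous [h] z w _.

Lemma translate_continuous h w : continuous h -> continuous (fun z => h (z + w)).
Proof.
move=> ch z; apply: continuous_comp; last exact: ch.
by apply: cvgD; [exact: cvg_id|exact: cvg_cst].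
Qed.

Arguments translate_continuous [h] w _.

Lemma primitive_bound_sym (f F : R -> R) a b e : primitive f F ->
  (forall x, `|x - a| <= `|b - a| -> `|f x| <= e) ->
  `|F b - F a| <= e * `|b - a|.
Proof.
move=> fF fe; have [ab|/ltW ba] := leP a b.
  rewrite [X in _ * X]ger0_norm ?subr_ge0//.
  apply: primitive_bound => // x /andP[ax xb]; apply: fe.
  by rewrite !ger0_norm ?subr_ge0// lerD2r.
rewrite distrC [X in _ * X]ler0_norm ?subr_le0// opprB.
apply: primitive_bound => // x /andP[bx xa]; apply: fe.
by rewrite !ler0_norm ?subr_le0// lerN2 lerD2r.
Qed.

Lemma integ_bound_sym (f : R -> R) d e : continuous f ->
  (forall x, `|x| <= `|d| -> `|f x| <= e) -> `|integ f d| <= e * `|d|.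
Proof.
move=> /primitive_exists[F fF] fe; rewrite (integE d fF).
have := primitive_bound_sym (a := 0) (b := d) (e := e) fF.
by rewrite subr0; apply=> x; rewrite subr0; exact: fe.
Qed.

Definition pint s w h z := integ (fun t => h (z + t *: w)) s.

Lemma compact_symitv d : compact [set t : R | `|t| <= d].
Proof.
have -> : [set t : R | `|t| <= d] = `[- d, d]%classic.
  by apply/seteqP; split => t /=; rewrite in_itv/= ler_norml.
exact: segment_compact.
Qed.

(** Tube lemma: joint continuity at the points of [K] times [x] becomes uniform in the compact
    variable. *)
Lemma near_compact_uniform (T : topologicalType) (K : set R) (f : R -> T -> R)
    (x : T) e : compact K ->
  (forall t, (fun p : R * T => f p.1 p.2) @ (t, x) --> f t x) -> 0 < e ->
  \forall y \near x, forall t, K t -> `|f t x - f t y| <= e.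
Proof.
move=> /compact_near_coveringP cK cf e0.
suff : \forall y \near x, K `<=` (fun t => `|f t x - f t y| <= e).
  by apply: filterS => y H t; exact: H.
apply: (cK T (nbhs x) (fun y t => `|f t x - f t y| <= e) _) => t _.
have c1 : (fun p : R * T => f p.1 x) @ (t, x) --> f t x.
  apply: (@cvg_comp _ _ _ (fun p : R * T => (p.1, x)) (fun p => f p.1 p.2) _
    (nbhs (t, x))); last exact: cf.
  apply: (cvg_pair (G := nbhs t) (H := nbhs x)); [exact: cvg_fst|exact: cvg_cst].
have c12 : (fun p : R * T => f p.1 x - f p.1 p.2) @ (t, x) --> (0 : R).
  by rewrite -(subrr (f t x)); apply: cvgB => //; exact: cf.
exact: (cvgr0_norm_le _ c12 _ e0).
Qed.

Lemma pint_continuous s w h : continuous h -> continuous (pint s w h).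
Proof.
move=> ch z; apply/cvgrPdist_le => e e0.
have s1 : 0 < `|s| + 1 by rewrite ltr_wpDl.
have e1 : 0 < e / (`|s| + 1) by rewrite divr_gt0.
have H : \forall z' \near z, forall t, `|t| <= `|s| ->
    `|h (z + t *: w) - h (z' + t *: w)| <= e / (`|s| + 1).
  apply: (near_compact_uniform (f := fun t z' => h (z' + t *: w))
    (compact_symitv (d := `|s|))) => // t.
  apply: continuous_cvg; first exact: ch.
  by apply: cvgD; [exact: cvg_snd|apply: cvgZr_tmp; exact: cvg_fst].
near=> z'.
have Hz' t : `|t| <= `|s| ->
  `|h (z + t *: w) - h (z' + t *: w)| <= e / (`|s| + 1) by apply: (near H z').
rewrite /pint -integB; [|exact: line_continuous..].
apply: (@le_trans _ _ (e / (`|s| + 1) * `|s|)).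
  apply: integ_bound_sym => [t|t ts]; last exact: Hz'.
  by apply: cvgB; exact: line_continuous.
by rewrite mulrAC ler_pdivrMr// ler_pM2l// lerDl.
Unshelve. all: by end_near. Qed.

Lemma pint_translate s w h a z : pint s w (fun y => h (y + a)) z = pint s w h (z + a).
Proof. by rewrite /pint; congr integ; apply/funext => t; rewrite addrAC. Qed.

Lemma pintB s w f g : continuous f -> continuous g ->
  pint s w (fun y => f y - g y) = (fun z => pint s w f z - pint s w g z).
Proof.
move=> cf cg; apply/funext => z; rewrite /pint integB//; exact: line_continuous.
Qed.

Lemma pintZ s w c h : continuous h ->
  pint s w (fun y => c * h y) = (fun z => c * pint s w h z).
Proof.
move=> ch; apply/funext => z; rewrite /pint.
have [F hF] := primitive_exists (line_continuous z w ch).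
have chF : primitive (fun t => c * h (z + t *: w)) (fun t => c * F t).
  by move=> t; exact: is_deriveZ.
by rewrite (integE _ hF) (integE _ chF) mulrBr.
Qed.

(** Fubini's theorem without measures: as a function of the upper limit [s], the left-hand side
    vanishes at 0 and is a primitive of the inner integral on the right. Differentiating under the
    integral sign rests on [near_compact_uniform]. *)
Lemma pintC s d v w h : continuous h ->
  pint d v (pint s w h) = pint s w (pint d v h).
Proof.
move=> ch; apply/funext => z.
pose G s' := pint d v (pint s' w h) z.
suff GP : primitive (fun r => pint d v h (z + r *: w)) G.
  have -> : pint s w (pint d v h) z = G s - G 0 by exact: integE.
  suff -> : G 0 = 0 by rewrite subr0.
  suff E0 : pint 0 w h = fun=> 0 by rewrite /G E0 /pint integ_cst mul0r.
  apply/funext => y; rewrite /pint.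
  have [F hF] := primitive_exists (line_continuous y w ch).
  by rewrite (integE _ hF) subrr.
move=> r; apply: is_derive_intro => e e0.
have d1 : 0 < `|d| + 1 by rewrite ltr_wpDl.
have e1 : 0 < e / (`|d| + 1) by rewrite divr_gt0.
have H : \forall r' \near r, forall t, `|t| <= `|d| ->
    `|h (z + t *: v + r *: w) - h (z + t *: v + r' *: w)| <= e / (`|d| + 1).
  pose f (t r' : R) := h (z + t *: v + r' *: w).
  have := @near_compact_uniform R [set t : R | `|t| <= `|d|] f r (e / (`|d| + 1)).
  apply => //; first exact: compact_symitv.
  move=> t.
  apply: continuous_cvg; first exact: ch.
  apply: cvgD; last by apply: cvgZr_tmp; exact: cvg_snd.
  by apply: cvgD; [exact: cvg_cst|apply: cvgZr_tmp; exact: cvg_fst].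
have [rho /= rho0 Hrho] := (nbhs_ballP _ _).1 H.
near=> y.
have yrho : `|y| < rho.
  by near: y; apply: cvgr0_norm_lt => //; exact: cvg_id.
have cp s' : continuous (pint s' w h) by exact: pint_continuous.
have -> : y * pint d v h (z + r *: w) =
    integ (fun t => y * h (z + t *: v + r *: w)) d.
  rewrite -[RHS]/(integ (fun t => y * h (z + t *: v + r *: w)) d).
  have := congr1 (fun f => f (z + r *: w)) (pintZ d v y ch) => /= <-.
  by rewrite /pint; congr integ; apply/funext => t; rewrite addrAC.
have cl s' := line_continuous z v (cp s').
have clr : continuous (fun t : R => y * h (z + t *: v + r *: w)).
  move=> t; apply: cvgM; first exact: cvg_cst.
  exact: (line_continuous z v (translate_continuous (r *: w) ch)).
have cB : continuous (fun t : R =>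
    pint (r + y) w h (z + t *: v) - pint r w h (z + t *: v)).
  by move=> t; apply: cvgB; exact: cl.
rewrite /G -[pint d v (pint (r + y) w h) z]/(integ
  (fun t => pint (r + y) w h (z + t *: v)) d).
rewrite -[pint d v (pint r w h) z]/(integ (fun t => pint r w h (z + t *: v)) d).
rewrite -integB// -integB//.
apply: (@le_trans _ _ (e / (`|d| + 1) * `|y| * `|d|)).
  apply: integ_bound_sym => [t|t td]; first by apply: cvgB; [exact: cB|exact: clr].
  have [F hF] := primitive_exists (line_continuous (z + t *: v) w ch).
  rewrite /pint !(integE _ hF).
  have P := primitiveB hF (primitive_cst (h (z + t *: v + r *: w))).
  have := primitive_bound_sym (a := r) (b := r + y) (e := e / (`|d| + 1)) P.
  rewrite /= (_ : r + y - r = y); last by ring.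
  set X := (X in _ -> `|X| <= _); set Y := (Y in `|Y| <= _).
  have -> : Y = X by rewrite /X /Y; ring.
  apply=> x xr /=.
  have /Hrho/(_ t td) : ball r rho x by rewrite -ball_normE /= distrC (le_lt_trans xr).
  by rewrite (distrC (h _)).
have -> : e / (`|d| + 1) * `|y| * `|d| = e * `|y| * `|d| / (`|d| + 1) by ring.
by rewrite ler_pdivrMr// ler_wpM2l ?lerDl// mulr_ge0// ltW.
Unshelve. all: by end_near. Qed.

(** * Averages and difference quotients with a fixed step *)

Section avg.
Variable d : R.
Hypothesis d0 : 0 < d.

Definition avg w h z := d^-1 * pint d w h z.
Definition dquot w h z := d^-1 * (h (z + d *: w) - h z).

Lemma avg_continuous w h : continuous h -> continuous (avg w h).
Proof. by move=> ch z; apply: cvgM; [exact: cvg_cst|exact: pint_continuous]. Qed.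

Lemma dquot_continuous w h : continuous h -> continuous (dquot w h).
Proof.
move=> ch z; apply: cvgM; first exact: cvg_cst.
by apply: cvgB; [exact: (translate_continuous (d *: w) ch)|exact: ch].
Qed.

Lemma avgC v w h : continuous h -> avg v (avg w h) = avg w (avg v h).
Proof.
move=> ch; apply/funext => z; rewrite /avg.
by rewrite !pintZ ?(pintC d d v w ch)//; exact: pint_continuous.
Qed.

Lemma avgB w f g : continuous f -> continuous g ->
  avg w (fun y => f y - g y) = (fun z => avg w f z - avg w g z).
Proof. by move=> cf cg; apply/funext => z; rewrite /avg pintB// mulrBr. Qed.

Lemma dquotC v w h : dquot v (dquot w h) = dquot w (dquot v h).
Proof.
by apply/funext => z; rewrite /dquot (addrAC z (d *: v)); ring.
Qed.

Lemma dquot_avg v w h : continuous h -> dquot v (avg w h) = avg w (dquot v h).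
Proof.
move=> ch; apply/funext => z; rewrite /avg /dquot.
have ct := translate_continuous (d *: v) ch.
rewrite pintZ; last by move=> y; apply: cvgB; [exact: ct|exact: ch].
by rewrite pintB// pint_translate -mulrBr.
Qed.

Lemma is_derive_line h z w (l : R) :
  is_derive (0 : R) (1 : R) (fun t => h (z + t *: w)) l -> is_derive z w h l.
Proof.
move=> [dh hl].
have E : (fun t : R => h (z + t *: w)) = (fun t : R => h (t *: w + z)).
  by apply/funext => t; rewrite addrC.
have dz : derivable h z w by apply/derivable1P; rewrite -E.
apply: DeriveDef => //; rewrite -hl E /derive.
set g1 := fun t : R => t^-1 *: _; set g2 := fun t : R => t^-1 *: _.
suff -> : g1 = g2 by [].
apply/funext => t; rewrite /g1 /g2 /=.
by rewrite addr0 scale0r add0r [t *: 1]mulr1.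
Qed.

(** Moving [z] along [w] slides the segment of integration, so only its two endpoints contribute.
    Averaging thus gains one derivative in the direction [w] from mere continuity. *)
Lemma is_derive_avg w h z : continuous h -> is_derive z w (avg w h) (dquot w h z).
Proof.
move=> ch; apply: is_derive_line.
have [F hF] := primitive_exists (line_continuous z w ch).
have -> : (fun t => avg w h (z + t *: w)) = (fun t => d^-1 * (F (d + t) - F t)).
  apply/funext => t; rewrite /avg /pint; congr (_ * _).
  have := primitive_shift t hF.
  under eq_fun do rewrite scalerDl addrA.
  by move=> /(integE d) ->; rewrite addr0 (addrC t d).
have P := primitive_shift d hF.
have D := is_deriveZ d^-1 (is_deriveB (P 0) (hF 0)).
rewrite addr0 scale0r addr0 in D.
exact: D.
Qed.

(** The segment of integration has length at most [d], so each average costs [d] in the radius. The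
    case [c = 0], [e = 0] yields locality in [avg_ext]. *)
Lemma avg_local w h z (r c e : R) : `|w| <= 1 -> continuous h ->
  (forall y, `|y - z| <= r + d -> `|h y - c| <= e) ->
  forall y, `|y - z| <= r -> `|avg w h y - c| <= e.
Proof.
move=> w1 ch H y yz.
have -> : avg w h y - c = d^-1 * integ (fun t => h (y + t *: w) - c) d.
  rewrite integB; [|exact: line_continuous|by move=> ?; exact: cvg_cst].
  by rewrite integ_cst mulrBr [c * d]mulrC mulKf ?gt_eqF.
rewrite normrM gtr0_norm ?invr_gt0// ler_pdivrMl// mulrC.
apply: integ_bound => [t||t /andP[t0 td]]; last 2 first.
- exact: ltW.
- apply: H; rewrite addrAC; apply: le_trans (ler_normD _ _) _.
  by rewrite lerD// normrZ ger0_norm// (le_trans _ td)// ler_piMr.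
by apply: cvgB; [exact: line_continuous|exact: cvg_cst].
Qed.

Lemma avg_ext w f g z (r : R) : `|w| <= 1 -> continuous f -> continuous g ->
  (forall y, `|y - z| <= r + d -> f y = g y) ->
  forall y, `|y - z| <= r -> avg w f y = avg w g y.
Proof.
move=> w1 cf cg fg y yz.
have cB : continuous (fun y => f y - g y).
  by move=> x; apply: cvgB; [exact: cf|exact: cg].
have := avg_local (c := 0) (e := 0) w1 cB _ yz.
rewrite avgB// subr0 normr_le0 subr_eq0 => H; apply/eqP/H => x xz.
by rewrite fg// subrr subr0 normr0.
Qed.

Lemma dquot_ext w f g z (r : R) : `|w| <= 1 ->
  (forall y, `|y - z| <= r + d -> f y = g y) ->
  forall y, `|y - z| <= r -> dquot w f y = dquot w g y.
Proof.
move=> w1 fg y yz; rewrite /dquot !fg//; first by rewrite (le_trans yz)// lerDl ltW.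
rewrite addrAC; apply: le_trans (ler_normD _ _) _.
by rewrite lerD// normrZ gtr0_norm// ler_piMr// ltW.
Qed.

Definition avgs (l : seq V) h := foldr avg h l.

Lemma avgs_continuous l h : continuous h -> continuous (avgs l h).
Proof. by move=> ch; elim: l => //= w l; exact: avg_continuous. Qed.

Lemma avgsB l f g : continuous f -> continuous g ->
  avgs l (fun y => f y - g y) = (fun z => avgs l f z - avgs l g z).
Proof.
by move=> cf cg; elim: l => //= w l ->; rewrite avgB//; exact: avgs_continuous.
Qed.

(** Since averages commute, any direction in the list can be brought to the front, where the
    derivative is known. *)
Lemma avgs_perm l1 l2 h : continuous h -> perm_eq l1 l2 -> avgs l1 h = avgs l2 h.
Proof.
move=> ch.
have avgs_rem w l : w \in l -> avgs l h = avg w (avgs (rem w l) h).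
  elim: l => //= v l IH; rewrite inE; case: eqVneq => [->//|vw /= wl].
  by rewrite IH// avgC//; exact: avgs_continuous.
elim: l1 l2 => [|w l1 IH] l2; first by rewrite perm_sym => /perm_nilP ->.
move=> pl; have wl2 : w \in l2 by rewrite -(perm_mem pl) mem_head.
rewrite (avgs_rem w l2 wl2) /=; congr avg; apply: IH.
by rewrite -(perm_cons w) (permPl pl) perm_to_rem.
Qed.

Lemma avgs_local l h z (r c e : R) : {in l, forall w, `|w| <= 1} -> continuous h ->
  (forall y, `|y - z| <= r + (size l)%:R * d -> `|h y - c| <= e) ->
  forall y, `|y - z| <= r -> `|avgs l h y - c| <= e.
Proof.
move=> + ch; elim: l r => [|w l IH] r l1 H; first by move: H; rewrite mul0r addr0.
apply: avg_local; [exact/l1/mem_head|exact: avgs_continuous|].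
apply: IH => [v vl|y yz]; first by apply: l1; rewrite inE vl orbT.
by apply: H; rewrite (le_trans yz)//= -natr1 mulrDl mul1r addrA addrAC.
Qed.

Lemma avg_avgs w l h : continuous h -> avg w (avgs l h) = avgs l (avg w h).
Proof.
move=> ch; elim: l => //= v l IH.
by rewrite -IH avgC//; exact: avgs_continuous.
Qed.

Lemma dquot_avgs w l h : continuous h -> dquot w (avgs l h) = avgs l (dquot w h).
Proof.
move=> ch; elim: l => //= v l IH.
by rewrite -IH dquot_avg//; exact: avgs_continuous.
Qed.

Lemma derive_avgs v l l' h : continuous h -> perm_eq l (v :: l') ->
  forall z, is_derive z v (avgs l h) (dquot v (avgs l' h) z).
Proof.
move=> ch pl z; rewrite (avgs_perm ch pl) /=.
by apply: is_derive_avg; exact: avgs_continuous.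
Qed.

Lemma derive_avgsE v l l' h : continuous h -> perm_eq l (v :: l') ->
  'D_v (avgs l h) = dquot v (avgs l' h).
Proof.
by move=> ch pl; apply/funext => z; have [_ ->] := derive_avgs ch pl z.
Qed.

(** Each derivative consumes one average in its own direction and leaves a difference quotient,
    which commutes with the remaining averages. *)
Lemma derive2_avgs v w l l' h : continuous h -> perm_eq l [:: v, w & l'] ->
  forall z, is_derive z w ('D_v (avgs l h)) (dquot w (dquot v (avgs l' h)) z).
Proof.
move=> ch pl z; rewrite (derive_avgsE ch pl) /= dquot_avg; last exact: avgs_continuous.
by apply: is_derive_avg; apply: dquot_continuous; exact: avgs_continuous.
Qed.

Lemma derive2_avgsE v w l l' h : continuous h -> perm_eq l [:: v, w & l'] ->
  'D_w ('D_v (avgs l h)) = dquot w (dquot v (avgs l' h)).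
Proof.
by move=> ch pl; apply/funext => z; have [_ ->] := derive2_avgs ch pl z.
Qed.

(* The hypotheses express that [H + i K] has vanishing integral on the boundary
   of every small square in the complex line spanned by [x]. *)
Lemma laplacian_avgs (H K : V -> R) x y l l' z :
  continuous H -> continuous K -> `|x| <= 1 -> `|y| <= 1 ->
  {in l', forall w, `|w| <= 1} ->
  perm_eq l [:: x, x, y, y & l'] ->
  (forall p, `|p - z| <= ((size l').+2)%:R * d ->
    dquot x (avg y H) p = dquot y (avg x K) p /\
    dquot y (avg x H) p = - dquot x (avg y K) p) ->
  'D_x ('D_x (avgs l H)) z + 'D_y ('D_y (avgs l H)) z = 0.
Proof.
move=> cH cK x1 y1 l1 pl CR.
have pl2 : perm_eq l [:: y, y, x, x & l'].
  by rewrite (permPl pl) (perm_catC [:: x; x] [:: y, y & l']) /= !perm_cons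
    -[[:: x, x & l']]/([:: x; x] ++ l') perm_catC.
have [_ ->] := derive2_avgs cH pl z; have [_ ->] := derive2_avgs cH pl2 z.
have cA w f : continuous f -> continuous (avg w f) by exact: avg_continuous.
have cD w f : continuous f -> continuous (dquot w f) by exact: dquot_continuous.
(* [E] is the Laplacian in the plane of [x] and [y] before the remaining averages [l'] are
   applied. *)
pose E p := dquot x (dquot x (avg y (avg y H))) p +
  dquot y (dquot y (avg x (avg x H))) p.
have cxx : continuous (dquot x (dquot x (avg y (avg y H)))) by exact/cD/cD/cA/cA.
have cyy : continuous (dquot y (dquot y (avg x (avg x H)))) by exact/cD/cD/cA/cA.
have cE : continuous E by move=> p; apply: cvgD; [exact: cxx|exact: cyy].
have cyK : continuous (dquot x (avg y K)) by exact/cD/cA.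
have cyK' : continuous (fun q => 0 - dquot x (avg y K) q).
  by move=> q; apply: cvgB; [exact: cvg_cst|exact: cyK].
have E0 p : `|p - z| <= (size l')%:R * d -> E p = 0.
  move=> pz.
  have A q : `|q - z| <= ((size l').+2)%:R * d ->
      dquot x (avg y H) q = dquot y (avg x K) q.
    by move=> /CR[].
  have B q : `|q - z| <= ((size l').+2)%:R * d ->
      dquot y (avg x H) q = 0 - dquot x (avg y K) q.
    by move=> /CR[_ ->]; rewrite sub0r.
  rewrite /E.
  have -> : dquot x (dquot x (avg y (avg y H))) p =
      dquot x (avg y (dquot x (avg y H))) p.
    by rewrite (dquot_avg x y (h := avg y H))//; exact: cA.
  have -> : dquot y (dquot y (avg x (avg x H))) p =
      dquot y (avg x (dquot y (avg x H))) p.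
    by rewrite (dquot_avg y x (h := avg x H))//; exact: cA.
  (* The outer quotient and the outer average each reach a further distance [d], which explains the
     radius at which the discrete Cauchy-Riemann equations are assumed. *)
  have rr : ((size l').+2)%:R * d = (size l')%:R * d + d + d.
    by rewrite -!natr1 !mulrDl mul1r.
  have -> : dquot x (avg y (dquot x (avg y H))) p =
      dquot x (avg y (dquot y (avg x K))) p.
    apply: (dquot_ext (z := z) (r := (size l')%:R * d)) => //.
    by apply: avg_ext => //; [exact/cD/cA|exact/cD/cA|rewrite -rr].
  have -> : dquot y (avg x (dquot y (avg x H))) p =
      dquot y (avg x (fun q => 0 - dquot x (avg y K) q)) p.
    apply: (dquot_ext (z := z) (r := (size l')%:R * d)) => //.
    by apply: avg_ext => //; [exact/cD/cA|rewrite -rr].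
  rewrite avgB; [|by move=> ?; exact: cvg_cst|exact: cyK].
  have -> : dquot x (avg y (dquot y (avg x K))) = dquot y (avg x (dquot x (avg y K))).
    rewrite -(dquot_avg y y (h := avg x K)); last exact: cA.
    rewrite -(dquot_avg x x (h := avg y K)); last exact: cA.
    by rewrite dquotC (avgC y x).
  rewrite {3}/avg /pint integ_cst /dquot.
  by ring.
have Aq a b : dquot a (dquot a (avg b (avg b (avgs l' H)))) =
    avgs l' (dquot a (dquot a (avg b (avg b H)))).
  rewrite (avg_avgs b l' cH) (avg_avgs b l' (cA b H cH)).
  rewrite (dquot_avgs a l' (cA b _ (cA b H cH))).
  by rewrite (dquot_avgs a l' (cD a _ (cA b _ (cA b H cH)))).
rewrite /= !Aq.
(* This turns the sum into [avgs d l' E] at [z], which vanishes because [E] does within the reach of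
   these averages. *)
have -> : dquot x (dquot x (avg y (avg y H))) =
    (fun p => E p - dquot y (dquot y (avg x (avg x H))) p).
  by apply/funext => p; rewrite /E addrK.
rewrite avgsB// subrK; apply/eqP; rewrite -normr_le0 -[X in `|X|]subr0.
apply: (avgs_local (r := 0) (z := z)) => //; last by rewrite subrr normr0.
by move=> p; rewrite add0r subr0 => /E0 ->; rewrite normr0.
Qed.

End avg.

End Averages.

(** * Approximation by harmonic functions *)

Section HolomorphicApproximation.
Set Implicit Arguments. Unset Strict Implicit. Unset Printing Implicit Defensive.
Context {R : realType}.

(** A Urysohn function is flattened so that it is 1 near [K] and 0 near every point outside [U].
    Products with it are continuous everywhere although [f] is controlled only on [U], so averages
    can be taken globally. *)
Lemma cutoff_exists (V : pseudoMetricType R) (U K : set V) :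
  open U -> closed K -> K `<=` U -> exists (N : set V) (chi : V -> R),
  [/\ open N, K `<=` N, N `<=` U, forall z, N z -> chi z = 1 &
    forall f : V -> R, (forall z, U z -> {for z, continuous f}) ->
      continuous (fun z => chi z * f z)].
Proof.
move=> oU cK KU.
have dis : ~` U `&` K = set0 by apply/disjoints_subset => z /= nUz /KU.
have [f [cf f0 f1 _]] := urysohn_ext_itv (R := R) pseudometric_normal
  (open_closedC oU) cK dis ltr01.
have openf (A : set R) : open A -> open (f @^-1` A).
  by move=> oA; apply: open_comp => // z _; exact: cf.
pose clamp (x : R) := (`|3 * x - 1| - `|3 * x - 2| + 1) / 2.
have clamp_cont : continuous clamp.
  have lin c : continuous (fun x : R => `|3 * x - c|).
    move=> x; apply: cvg_norm; apply: cvgB; last exact: cvg_cst.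
    by apply: cvgM; [exact: cvg_cst|exact: cvg_id].
  move=> x; apply: cvgM; last exact: cvg_cst.
  by apply: cvgD; [apply: cvgB; exact: lin|exact: cvg_cst].
have clamp0 x : x < 1 / 3 -> clamp x = 0.
  by move=> x3; rewrite /clamp !ler0_norm; lra.
have clamp1 x : 2 / 3 < x -> clamp x = 1.
  by move=> x3; rewrite /clamp !ger0_norm; lra.
exists (f @^-1` [set x | 2 / 3 < x]), (clamp \o f); split.
- exact/openf/open_gt.
- by move=> z Kz /=; rewrite (f1 (f z)); [lra|exists z].
- move=> z /= fz; apply: contrapT => nUz.
  by have : f z = 0 by [apply: f0; exists z]; move: fz => /[swap] ->; lra.
- by move=> z fz; exact: clamp1.
move=> g cg z; have [Uz|nUz] := pselect (U z).
  apply: cvgM; last exact: cg.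
  by apply: continuous_comp; [exact: cf|exact: clamp_cont].
have near0 : \forall y \near z, 0 = clamp (f y) * g y.
  have : nbhs z (f @^-1` [set x | x < 1 / 3]).
    apply: open_nbhs_nbhs; split; first exact/openf/open_lt.
    by rewrite /= (f0 (f z)); [lra|exists z].
  by apply: filterS => y /= fy; rewrite clamp0// mul0r.
rewrite /continuous_at /= -(nbhs_singleton near0).
exact: cvg_trans (near_eq_cvg near0) (cvg_cst _).
Qed.

(** Uniform continuity at the points of [K], where the second point [y] may leave [K] but stays in
    [N]. *)
Lemma compact_unif_nbhs (V : normedModType R) (K N : set V) (f : V -> R) (e : R) :
  compact K -> open N -> K `<=` N -> continuous f -> 0 < e ->
  exists2 r, 0 < r & forall z, K z -> forall y, `|y - z| <= r ->
    N y /\ `|f y - f z| <= e.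
Proof.
move=> /compact_near_coveringP cK oN KN cf e0.
have : \forall r \near 0^'+, K `<=`
    (fun z => forall y, `|y - z| <= r -> N y /\ `|f y - f z| <= e).
  apply: (cK R 0^'+ (fun r z => forall y, `|y - z| <= r ->
    N y /\ `|f y - f z| <= e) _) => z Kz.
  have e2 : 0 < e / 2 by rewrite divr_gt0.
  have : nbhs z (fun y => N y /\ `|f z - f y| <= e / 2).
    apply: filterI; first exact: (open_nbhs_nbhs (conj oN (KN _ Kz))).
    exact: (cvgr_dist_le _ _ (cf z) _ e2).
  move=> /nbhs_ballP[s /= s0 zs].
  have s2 : 0 < s / 2 by rewrite divr_gt0.
  near=> z' r => y yz' /=.
  have z'z : `|z - z'| < s / 2.
    by near: z'; apply: cvgr_dist_lt => //; exact: cvg_id.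
  have rs : r < s / 2 by near: r; exact: nbhs_right_lt.
  have /zs[Ny fy] : ball z s y.
    rewrite -ball_normE /= (_ : z - y = (z - z') - (y - z')).
      by apply: le_lt_trans (ler_normB _ _) _;
        rewrite (splitr s) ltrD// (le_lt_trans yz').
    by rewrite opprB addrA subrK.
  have /zs[_ fz'] : ball z s z'.
    by rewrite -ball_normE /= (lt_trans z'z)// ltr_pdivrMr// ltr_pMr// ltr1n.
  split=> //; move: fy fz'; rewrite !ler_norml => /andP[? ?] /andP[? ?].
  by apply/andP; split; lra.
move=> H; have [r []] := filter_ex (filterI H (nbhs_right_gt (0 : R))).
by exists r.
Unshelve. all: by end_near. Qed.

Lemma differentiable_near (V W : normedModType R) (f : V -> W) (q : V) :
  differentiable f q -> forall e, 0 < e ->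
  \forall y \near q, `|f y - f q - 'd f q (y - q)| <= e * `|y - q|.
Proof.
move=> /diff_locallyP[_ /eqaddoP H] e e0.
have /nbhs_ballP[s /= s0 zs] : nbhs (0 : V) _ := H e e0.
apply/nbhs_ballP; exists s => //= y; rewrite -ball_normE /= => qy.
have /zs /= : ball (0 : V) s (y - q) by rewrite -ball_normE /= sub0r opprB.
by rewrite !fctE /= subrK opprD addrA.
Qed.

Definition approx_linear (V : normedModType R) (f : V -> R) (q : V) (L : V -> R) :=
  forall e, 0 < e -> \forall y \near q, `|f y - f q - L (y - q)| <= e * `|y - q|.

(** Goursat's theorem on the parallelogram at [p] with sides [d *: x] and [d *: y], divided by the
    square of [d]. The condition [LP y = LQ x] expresses closedness of the form. *)
Lemma goursat_dquot_avg (V : normedModType R) (P Q : V -> R) (p x y : V) (d : R) :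
  0 < d -> `|x| <= 1 -> `|y| <= 1 -> continuous P -> continuous Q ->
  (forall a b, 0 <= a <= d -> 0 <= b <= d -> exists LP LQ : {linear V -> R},
    [/\ approx_linear P (p + a *: x + b *: y) LP,
        approx_linear Q (p + a *: x + b *: y) LQ & LP y = LQ x]) ->
  dquot d y (avg d x P) p = dquot d x (avg d y Q) p.
Proof.
move=> d0 x1 y1 cP cQ H.
have line_cont (f : V -> R) (z w : V) : continuous f ->
    continuous (fun t : R => f (z + t *: w) : R).
  by move=> cf; exact: line_continuous.
have E1 b z : (fun t : R => P (z + t *: x + b *: y)) =
    (fun t : R => P ((z + b *: y) + t *: x)).
  by apply/funext => t; rewrite addrAC.
have := @goursat_square R (fun a b => P (p + a *: x + b *: y))
  (fun a b => Q (p + a *: x + b *: y)) d d0.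
have cPl b : continuous (fun t : R => P (p + t *: x + b *: y)).
  by rewrite E1; exact: (line_cont P (p + b *: y) x cP).
have cQl a : continuous (fun t : R => Q (p + a *: x + t *: y)).
  exact: (line_cont Q (p + a *: x) y cQ).
move=> /(_ cPl cQl) G.
have : integ (fun t => P (p + t *: x + d *: y) - P (p + t *: x + 0 *: y)) d =
       integ (fun t => Q (p + d *: x + t *: y) - Q (p + 0 *: x + t *: y)) d.
  apply: G => a b ad bd; have [LP [LQ [HP HQ LL]]] := H a b ad bd.
  exists (LP x), (LP y), (LQ y) => e e0.
  pose q := p + a *: x + b *: y.
  have : \forall r \near q, `|P r - P q - LP (r - q)| <= e * `|r - q| /\
      `|Q r - Q q - LQ (r - q)| <= e * `|r - q|.
    by apply: filterI; [exact: HP|exact: HQ].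
  move=> /nbhs_ballP[s /= s0 zs].
  exists (s / 3); first by rewrite divr_gt0.
  move=> a' b' aa' bb'.
  pose q' := p + a' *: x + b' *: y.
  have qq' : q' - q = (a' - a) *: x + (b' - b) *: y.
    rewrite /q /q' !scalerBl (opprD (p + _)) addrACA; congr (_ + _).
    by rewrite opprD addrACA subrr add0r.
  have nq : `|q' - q| <= `|a' - a| + `|b' - b|.
    rewrite qq'; apply: le_trans (ler_normD _ _) _.
    by rewrite !normrZ lerD// ler_piMr.
  have /zs[] : ball q s q'.
    by rewrite -ball_normE /= distrC; apply: le_lt_trans nq _; lra.
  have EL (L : {linear V -> R}) : L (q' - q) = L x * (a' - a) + L y * (b' - b).
    by rewrite qq' linearD !linearZ /= !(mulrC (L _)).
  rewrite !EL -LL => B1 B2.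
  have le : e * `|q' - q| <= e * (`|a' - a| + `|b' - b|) by rewrite ler_wpM2l// ltW.
  by split; [exact: le_trans B1 le|exact: le_trans B2 le].
rewrite integB; [|exact: cPl..]; rewrite integB; [|exact: cQl..].
rewrite /dquot /avg /pint !E1 !scale0r !addr0 => E.
by rewrite -!mulrBr E.
Qed.

End HolomorphicApproximation.

(** * Harmonic approximants in several complex variables *)

Section HarmonicApproximation.
Set Implicit Arguments. Unset Strict Implicit. Unset Printing Implicit Defensive.
Context {R : realType} {n : nat}.
Notation V := ('rV[R]_n * 'rV[R]_n)%type.
Implicit Types (H K : V -> R) (z w : V).

(** Complex differentiability of H + i K at the single point [z], stated on real differentials. *)
Definition cauchy_riemann H K z :=
  [/\ differentiable H z, differentiable K z &
      forall w, 'd H z (mulIn w) = - 'd K z w /\ 'd K z (mulIn w) = 'd H z w].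

Lemma mulIn_dirx (j : 'I_n) : mulIn (dirx R j) = diry R j.
Proof. by rewrite /mulIn /dirx /diry /= oppr0. Qed.

Lemma delta_norm (j : 'I_n) : `|delta_mx (0 : 'I_1) j : 'rV[R]_n| <= 1.
Proof.
rewrite [leLHS]/Num.norm /= mx_normrE; apply: bigmax_le => // -[i k] _ /=.
by rewrite mxE; case: (_ && _); rewrite ?normr1 ?normr0.
Qed.

Lemma dirx_norm (j : 'I_n) : `|dirx R j| <= 1.
Proof. by rewrite ProdNormedZmodule.prod_normE /= normr0 ge_max delta_norm ler01. Qed.

Lemma diry_norm (j : 'I_n) : `|diry R j| <= 1.
Proof. by rewrite ProdNormedZmodule.prod_normE /= normr0 ge_max delta_norm ler01. Qed.

(** Every basis direction occurs twice, so that all second derivatives exist, the repeated ones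
    included. *)
Definition all_dirs : seq V :=
  flatten [seq [:: dirx R j; dirx R j; diry R j; diry R j] | j <- enum 'I_n].

Lemma all_dirs_perm (j : 'I_n) : exists l,
  perm_eq all_dirs [:: dirx R j, dirx R j, diry R j, diry R j & l].
Proof.
exists (flatten [seq [:: dirx R k; dirx R k; diry R k; diry R k] |
  k <- rem j (enum 'I_n)]).
rewrite -[X in perm_eq _ X]/(flatten [seq [:: dirx R k; dirx R k; diry R k; diry R k] |
  k <- j :: rem j (enum 'I_n)]).
by apply/perm_flatten/perm_map/perm_to_rem; rewrite mem_enum.
Qed.

Lemma all_dirs_norm : {in all_dirs, forall w, `|w| <= 1}.
Proof.
move=> w /flatten_mapP[j _]; rewrite !inE.
by move=> /or4P[] /eqP ->; rewrite ?dirx_norm ?diry_norm.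
Qed.

Lemma all_dirs_count w : is_basis_dir w -> (1 < count_mem w all_dirs)%N.
Proof.
by move=> [j wj]; have [l /permP ->] := all_dirs_perm j; case: wj => ->;
  rewrite /= !eqxx; lia.
Qed.

Lemma all_dirs_perm2 v w : is_basis_dir v -> is_basis_dir w ->
  exists l, perm_eq all_dirs [:: v, w & l].
Proof.
move=> vb wb; exists (rem w (rem v all_dirs)).
have va : v \in all_dirs by rewrite -has_pred1 has_count ltnW// all_dirs_count.
rewrite (permPl (perm_to_rem va)) perm_cons perm_to_rem//.
rewrite -has_pred1 has_count count_mem_rem.
by have := all_dirs_count wb; case: eqP => _ /=; lia.
Qed.

Lemma avgs_C2 (d : R) (f : V -> R) (D : set V) : 0 < d -> continuous f ->
  C2_on D (avgs d all_dirs f).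
Proof.
move=> d0 cf; split=> [z _|v w vb wb z _]; first exact: avgs_continuous.
have [l pl] := all_dirs_perm2 vb wb.
have cl : continuous (avgs d l f) by exact: avgs_continuous.
have [dv _] := derive_avgs d cf pl z.
have [dw _] := derive2_avgs d cf pl z.
split => //.
- rewrite (derive_avgsE d cf pl); apply: dquot_continuous => //.
  exact: avgs_continuous.
- rewrite (derive2_avgsE d cf pl).
  by apply: dquot_continuous => //; exact: dquot_continuous.
Qed.

(** The approximant averages a cut-off of [H] over all directions. It is of class C^2 everywhere,
    but its Laplacian is controlled only on [C], where the averages do not see the cut-off. *)
Lemma harmonic_approximation (U C : set V) H K (e : R) :
  open U -> (forall z, U z -> cauchy_riemann H K z) ->
  compact C -> C `<=` U -> 0 < e ->
  exists h : V -> R, [/\ forall D, C2_on D h, forall z, C z -> laplacian h z = 0 &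
    forall z, C z -> `|h z - H z| <= e].
Proof.
move=> oU CR cC CU e0.
have [N [chi [oN CN NU chi1 chiC]]] :=
  cutoff_exists oU (compact_closed (@norm_hausdorff _ _) cC) CU.
pose f z := chi z * H z; pose g z := chi z * K z.
have cf : continuous f.
  by apply: chiC => z /CR[dH _ _]; exact: differentiable_continuous.
have cg : continuous g.
  by apply: chiC => z /CR[_ dK _]; exact: differentiable_continuous.
have fH z : N z -> f z = H z by move=> /chi1 E; rewrite /f E mul1r.
have gK z : N z -> g z = K z by move=> /chi1 E; rewrite /g E mul1r.
have [r r0 Hr] := compact_unif_nbhs cC oN CN cf e0.
(* The step [d] is so small that all [M] averages together move a point by at most [r]. *)
pose M := size all_dirs.
pose d := r / M.+1%:R.
have d0 : 0 < d by rewrite divr_gt0.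
have Md : M%:R * d <= r.
  by rewrite /d mulrCA ler_piMr ?(ltW r0)// ler_pdivrMr// mul1r ler_nat.
have appr (F G : V -> R) q : (forall y, N y -> G y = F y) -> N q ->
    differentiable F q -> approx_linear G q ('d F q).
  move=> GF Nq dF t t0.
  have nN : \forall y \near q, N y by exact: open_nbhs_nbhs.
  by apply: filterS2 nN (differentiable_near dF t0) => y Ny; rewrite !GF.
exists (avgs d all_dirs f); split.
- by move=> D; exact: avgs_C2.
- move=> z Cz; rewrite /laplacian big1// => j _.
  have [l pl] := all_dirs_perm j.
  have sl : (size l + 4 = M)%N by rewrite /M (perm_size pl) /=; lia.
  have l1 : {in l, forall w, `|w| <= 1}.
    by move=> w wl; apply: all_dirs_norm; rewrite (perm_mem pl) !inE wl !orbT.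
  have LA := laplacian_avgs d0 (K := g) (z := z) cf cg
    (dirx_norm j) (diry_norm j) l1 pl.
  apply: LA.
  move=> p pz.
  have Nq a b : 0 <= a <= d -> 0 <= b <= d -> N (p + a *: dirx R j + b *: diry R j).
    move=> /andP[a0 ad] /andP[b0 bd].
    suff : `|p + a *: dirx R j + b *: diry R j - z| <= r by move=> /(Hr z Cz)[].
    apply: le_trans Md.
    rewrite (_ : _ - z = (p - z) + a *: dirx R j + b *: diry R j); last first.
      by rewrite -!addrA; congr (_ + _); rewrite addrA addrC.
    have -> : M%:R * d = ((size l).+2)%:R * d + d + d.
      by rewrite -sl -addn2 !natrD; ring.
    apply: le_trans (ler_normD _ _) _; apply: lerD.
      apply: le_trans (ler_normD _ _) _; apply: lerD => //.
      by rewrite normrZ ger0_norm// (le_trans _ ad)// ler_piMr// dirx_norm.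
    by rewrite normrZ ger0_norm// (le_trans _ bd)// ler_piMr// diry_norm.
  split.
  + apply/esym; apply: goursat_dquot_avg => //; [exact: dirx_norm|exact: diry_norm|].
    move=> a b ad bd; have Nab := Nq a b ad bd.
    have [dH dK dHK] := CR _ (NU _ Nab).
    exists ('d K (p + a *: dirx R j + b *: diry R j)),
      ('d H (p + a *: dirx R j + b *: diry R j)).
    split; [exact: appr|exact: appr|].
    by have [_] := dHK (dirx R j); rewrite mulIn_dirx.
  (* The other Cauchy-Riemann equation says that the form with coefficients [H] and [- K] is closed
     too. *)
  + have cNg : continuous (fun y => 0 - g y).
      by move=> y; apply: cvgB; [exact: cvg_cst|exact: cg].
    transitivity (dquot d (dirx R j) (avg d (diry R j) (fun y => 0 - g y)) p).
      apply: goursat_dquot_avg => //; [exact: dirx_norm|exact: diry_norm|].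
      move=> a b ad bd; have Nab := Nq a b ad bd.
      have [dH dK dHK] := CR _ (NU _ Nab).
      exists ('d H (p + a *: dirx R j + b *: diry R j)),
        ('d (- K) (p + a *: dirx R j + b *: diry R j)).
      split; first exact: appr.
        apply: appr => //; last exact: differentiableN.
        by move=> y Ny; rewrite gK// sub0r.
      by have [+ _] := dHK (dirx R j); rewrite mulIn_dirx diffN.
    rewrite avgB; [|by move=> ?; exact: cvg_cst|exact: cg].
    rewrite /dquot {1 3}/avg /pint !integ_cst.
    by ring.
- move=> z Cz; rewrite -(fH z (CN z Cz)).
  have := @avgs_local R _ d d0 all_dirs f z 0 (f z) e all_dirs_norm cf _ z.
  apply; last by rewrite subrr normr0.
  by move=> y; rewrite add0r => yz; apply: (Hr z Cz y (le_trans yz Md)).2.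
Qed.

End HarmonicApproximation.

(** * Comparison with the Perron solution *)

Section HarmonicMeasureBound.
Set Implicit Arguments. Unset Strict Implicit. Unset Printing Implicit Defensive.
Context {R : realType} {n : nat}.
Notation V := ('rV[R]_n * 'rV[R]_n)%type.
Implicit Types (u v H K : V -> R) (z w : V).

(** * Calculus of Cauchy-Riemann pairs *)

Lemma cauchy_riemann_intro H K dH dK z :
  is_diff z H dH -> is_diff z K dK ->
  (forall w, dH (mulIn w) = - dK w /\ dK (mulIn w) = dH w) ->
  cauchy_riemann H K z.
Proof.
by case=> hH EH [] hK EK HK; rewrite /cauchy_riemann EH EK.
Qed.

Lemma cauchy_riemann_holomorphic (D : set V) u v z :
  holomorphic_on D (fun z => (u z, v z)) -> D z -> cauchy_riemann u v z.
Proof.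
move=> hol Dz; have [df CR] := hol z Dz.
set f := (fun z => (u z, v z)) in df CR.
have cfst : continuous (fst : R * R -> R) by move=> p; exact: cvg_fst.
have csnd : continuous (snd : R * R -> R) by move=> p; exact: cvg_snd.
have dfst : is_diff (f z) (fst : R * R -> R) (fst : R * R -> R).
  apply: DiffDef.
    exact: (linear_differentiable (f := fst : {linear (R * R)%type -> R^o})).
  exact: (diff_lin (f := fst : {linear (R * R)%type -> R^o})).
have dsnd : is_diff (f z) (snd : R * R -> R) (snd : R * R -> R).
  apply: DiffDef.
    exact: (linear_differentiable (f := snd : {linear (R * R)%type -> R^o})).
  exact: (diff_lin (f := snd : {linear (R * R)%type -> R^o})).
have d := differentiableP df.
apply: (cauchy_riemann_intro (is_diff_comp d dfst) (is_diff_comp d dsnd)) => w.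
by rewrite /= CR.
Qed.

Lemma cauchy_riemann0 z : cauchy_riemann (fun=> 0) (fun=> 0) z.
Proof.
apply: (cauchy_riemann_intro (is_diff_cst 0 z) (is_diff_cst 0 z)) => w.
by rewrite oppr0.
Qed.

Lemma cauchy_riemannD H K H' K' z : cauchy_riemann H K z -> cauchy_riemann H' K' z ->
  cauchy_riemann (fun y => H y + H' y) (fun y => K y + K' y) z.
Proof.
move=> [/differentiableP dH /differentiableP dK CR].
move=> [/differentiableP dH' /differentiableP dK' CR'].
apply: (cauchy_riemann_intro (is_diffD dH dH') (is_diffD dK dK')) => w.
have [h1 h2] := CR w; have [h3 h4] := CR' w.
have alg (a b c d : R) : a = - c -> b = - d -> a + b = - (c + d).
  by move=> -> ->; rewrite opprD.
exact: (conj (alg _ _ _ _ h1 h3) (congr2 +%R h2 h4)).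
Qed.

Lemma cauchy_riemannZ (c : R) H K z : cauchy_riemann H K z ->
  cauchy_riemann (fun y => c * H y) (fun y => c * K y) z.
Proof.
move=> [/differentiableP dH /differentiableP dK CR].
apply: (cauchy_riemann_intro (is_diffZ c dH) (is_diffZ c dK)) => w.
have [h1 h2] := CR w.
exact: (conj (etrans (congr1 ( *%R c) h1) (mulrN _ _)) (congr1 ( *%R c) h2)).
Qed.

Lemma cauchy_riemann_addc (c : R) H K z : cauchy_riemann H K z ->
  cauchy_riemann (fun y => H y + c) K z.
Proof.
move=> [/differentiableP dH dK CR]; have dc := is_diff_cst c z.
apply: (cauchy_riemann_intro (is_diffD dH dc) (differentiableP dK)) => w.
have [h1 h2] := CR w.
have E1 : 'd H z (mulIn w) + 0 = - 'd K z w by rewrite addr0.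
have E2 : 'd K z (mulIn w) = 'd H z w + 0 by rewrite addr0.
exact: (conj E1 E2).
Qed.

Lemma is_diff_comp1 (f : V -> R) (phi : R -> R) z (l : R) : differentiable f z ->
  is_derive (f z) 1 phi l -> is_diff z (fun y => phi (f y)) (fun w => l * 'd f z w).
Proof.
move=> /differentiableP df [dphi <-].
have dp : is_diff (f z) phi (fun h => h *: 'D_1 phi (f z)).
  apply: DiffDef; first exact/derivable1_diffP.
  by rewrite (deriv1E dphi) derive1E.
apply: is_diff_eq (is_diff_comp df dp) _.
by apply/funext => w /=; rewrite mulrC.
Qed.

Definition cosh (x : R) := (expR x + expR (- x)) / 2.
Definition sinh (x : R) := (expR x - expR (- x)) / 2.

Lemma is_derive_expRN (x : R) : is_derive x 1 (fun y : R => expR (- y)) (- expR (- x)).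
Proof.
have := is_derive1_comp (is_derive_expR (- x)) (is_deriveNid x (1 : R)).
by rewrite mulrN1.
Qed.

Lemma is_derive_cosh (x : R) : is_derive x 1 cosh (sinh x).
Proof.
have := is_deriveZ 2^-1 (is_deriveD (is_derive_expR x) (is_derive_expRN x)).
have -> : 2^-1 \*: (expR + (fun y => expR (- y))) = cosh.
  by apply/funext => y; rewrite /cosh mulrC.
by rewrite /sinh mulrC.
Qed.

Lemma is_derive_sinh (x : R) : is_derive x 1 sinh (cosh x).
Proof.
have := is_deriveZ 2^-1 (is_deriveB (is_derive_expR x) (is_derive_expRN x)).
have -> : 2^-1 \*: (expR - (fun y => expR (- y))) = sinh.
  by apply/funext => y; rewrite /sinh mulrC.
by rewrite /cosh mulrC opprK.
Qed.

(* Real and imaginary parts of [cos (c f)] for [f = u + i v]. *)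
Lemma cauchy_riemann_cos (c : R) u v z : cauchy_riemann u v z ->
  cauchy_riemann (fun y => cos (c * u y) * cosh (c * v y))
    (fun y => - (sin (c * u y) * sinh (c * v y))) z.
Proof.
move=> [du dv CR].
have scaled (f : V -> R) (phi : R -> R) (l : R) : differentiable f z ->
    is_derive (c * f z) 1 phi l ->
    is_diff z (fun y => phi (c * f y)) (fun w => c * l * 'd f z w).
  move=> df dphi; have dc : is_derive (f z) 1 (fun x : R => c * x) c.
    by have := is_deriveZ c (is_derive_id (f z) (1 : R)); rewrite [_ *: _]mulr1.
  by have := is_diff_comp1 df (is_derive1_comp dphi dc); rewrite mulrC.
have dC := scaled u cos _ du (is_derive_cos _).
have dS := scaled u sin _ du (is_derive_sin _).
have dCh := scaled v cosh _ dv (is_derive_cosh _).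
have dSh := scaled v sinh _ dv (is_derive_sinh _).
apply: (cauchy_riemann_intro (is_diffM dC dCh) (is_diffN (is_diffM dS dSh))) => w.
have [h1 h2] := CR w.
have alg (k s S C p q p' q' : R) : p' = - q -> q' = p ->
    k * (c * S * q') + C * (c * - s * p') = - - (s * (c * C * q) + S * (c * k * p)) /\
    - (s * (c * C * q') + S * (c * k * p')) = k * (c * S * q) + C * (c * - s * p).
  by move=> -> ->; split; ring.
exact: (alg (cos (c * u z)) (sin (c * u z)) (sinh (c * v z)) (cosh (c * v z))
  _ _ _ _ h1 h2).
Qed.

(** Each [s] of the Perron class is almost below [H] near the boundary. Elsewhere it is compared
    with a harmonic approximant of [H], raised slightly, on a relatively compact open subset of
    [D]. *)
Lemma perron_comparison (D Om : set V) (g : V -> R) H K z0 :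
  open D -> open Om -> rel_compact D Om ->
  (forall z, Om z -> cauchy_riemann H K z) ->
  (forall p, boundary D p -> g p <= H p) -> D z0 ->
  (harm_measure_integral D z0 g <= (H z0)%:E)%E.
Proof.
move=> oD oOm [cD DOm] CR gH Dz0.
apply: ge_ereal_sup => _ [s [[_ _ sub] sg] <-].
apply/lee_addgt0Pr => e e0; rewrite -EFinD.
have e4 : 0 < e / 4 by rewrite divr_gt0.
have cH z : Om z -> {for z, continuous H}.
  by move=> /CR[dH _ _]; exact: differentiable_continuous.
(* [W] is an open set around the boundary where the estimate holds: [e / 4] comes from the Perron
   class and [e / 4] from continuity of [H]. *)
pose W := [set z | D z -> (s z <= (H z + e / 2)%:E)%E]°.
have oW : open W by exact: open_interior.
have bW p : boundary D p -> W p.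
  move=> bp; rewrite /W.
  have Omp : Om p by apply: DOm; case: bp.
  have near1 := sg p bp _ e4.
  have near2 : \forall z \near p, `|H p - H z| <= e / 4.
    exact: (cvgr_dist_le _ _ (cH p Omp) _ e4).
  have : nbhs p [set z | D z -> (s z <= (H z + e / 2)%:E)%E].
    apply: filterS2 near1 near2 => z sz hz Dz.
    apply: le_trans (sz Dz) _; rewrite lee_fin.
    have := gH p bp; move: hz; rewrite ler_norml => /andP[? ?] ?; lra.
  by [].
have Ws z : W z -> D z -> (s z <= (H z + e / 2)%:E)%E.
  by move=> /interior_subset.
have [Wz0|nWz0] := pselect (W z0).
  by apply: le_trans (Ws _ Wz0 Dz0) _; rewrite lee_fin; lra.
pose A := closure D `\` W.
have clA : closed A.
  by apply: closedI; [exact: closed_closure|exact: open_closedC].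
have AD : A `<=` D.
  by move=> z [Dz nWz]; apply: contrapT => nDz; apply: nWz; apply: bW.
have dis : A `&` ~` D = set0 by apply/disjoints_subset; rewrite setCK.
(* Normality gives an open [G] around the rest [A] with closure inside [D]. A boundary point of [G]
   lies outside [A], hence in [W]. *)
have [G [G' [oG oG' AG DG' GG']]] :=
  (@normal_openP R _).1 pseudometric_normal _ _ clA (open_closedC oD) dis.
have clG : closure G `<=` D.
  have GG'c : G `<=` ~` G' by apply/disjoints_subset.
  move=> z /(closureS GG'c); rewrite -(closure_id _).1; last exact: open_closedC.
  by move=> nG'z; apply: contrapT => /DG'.
have GD : G `<=` D by move=> z Gz; apply: clG; exact: subset_closure.
(* Approximating [H] plus 3/4 of [e] within [e / 4] places [h] between [H + e / 2] and [H + e]. *)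
have [h [hC2 hlap hH]] := harmonic_approximation (C := closure D)
  oOm (fun z Oz => cauchy_riemann_addc (e / 4 + e / 2) (CR z Oz)) cD DOm e4.
have hcont : continuous h by move=> z; have [/(_ z I)] := hC2 setT.
have le_h z : D z -> H z + e / 2 <= h z <= H z + e.
  move=> Dz; have := hH z (subset_closure Dz); rewrite ler_norml => /andP[? ?].
  by apply/andP; split; lra.
apply: (@le_trans _ _ (h z0)%:E); last first.
  by rewrite lee_fin; case/andP: (le_h _ Dz0).
apply: (sub G h) => //.
- split=> //; apply: subclosed_compact cD _; first exact: closed_closure.
  exact: closureS.
- exact: continuous_subspaceT.
- by split=> //; split=> // z Gz; apply: hlap; apply: subset_closure; exact: GD.
- move=> p [clGp nGp]; have Dp := clG _ clGp.
  apply: (@le_trans _ _ (H p + e / 2)%:E); last first.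
    by rewrite lee_fin; case/andP: (le_h _ Dp).
  apply: Ws => //; apply: contrapT => nWp; apply/nGp/AG.
  by split=> //; exact: subset_closure.
- by apply: AG; split=> //; exact: subset_closure.
Qed.

End HarmonicMeasureBound.

(** * The majorant on the strip *)

Section StripMajorant.
Set Implicit Arguments. Unset Strict Implicit. Unset Printing Implicit Defensive.
Context {R : realType}.
Implicit Types (x y al : R) (k N : nat).

Definition frequency k : R := (1 - (2 ^+ k)^-1) * (pi / 2).

Lemma exp2_ge1 k : 1 <= (2 : R) ^+ k.
Proof. by rewrite exprn_ege1// ler1n. Qed.

Lemma exp2V_itv k : 0 < ((2 : R) ^+ k)^-1 <= 1.
Proof. by rewrite invr_gt0 exprn_gt0//= invf_le1 ?exprn_gt0// exp2_ge1. Qed.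

Lemma pihalf_ge0 : 0 <= pi / 2 :> R.
Proof. by rewrite divr_ge0// pi_ge0. Qed.

Lemma frequency_itv k : 0 <= frequency k <= pi / 2.
Proof.
have /andP[h0 h1] := exp2V_itv k; have p0 := pihalf_ge0.
rewrite /frequency mulr_ge0 ?subr_ge0//=.
by rewrite ler_piMl// lerBlDr lerDl ltW.
Qed.

(** Jordan's inequality at dyadic points, by halving: sin (2 t) = 2 sin t cos t is at most 2 sin
    t. *)
Lemma sin_dyadic_ge k : (2 ^+ k)^-1 <= sin ((2 ^+ k)^-1 * (pi / 2)) :> R.
Proof.
elim: k => [|k IH]; first by rewrite expr0 invr1 mul1r sin_pihalf.
have E : (2 ^+ k)^-1 = (2 ^+ k.+1)^-1 *+ 2 :> R.
  by rewrite -[RHS]mulr_natl exprS invfM mulVKf.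
move: IH; rewrite {1 2}E mulrnAl sin_mulr2n => IH.
have /andP[h0 h1] := exp2V_itv k.+1; have p0 := pihalf_ge0.
set t := (2 ^+ k.+1)^-1 in h0 h1 IH *.
have s0 : 0 <= sin (t * (pi / 2)).
  apply: sin_ge0_pi; rewrite mulr_ge0 ?(ltW h0)//=.
  by apply: (@le_trans _ _ (pi / 2)); [exact: ler_piMl|have := pi_ge0 R; lra].
have : cos (t * (pi / 2)) * sin (t * (pi / 2)) <= sin (t * (pi / 2)).
  by rewrite ler_piMl// cos_le1.
by lra.
Qed.

(** The cosine decreases on [0, pi], so the worst case is |x| = 1, where it equals the sine of the
    complementary angle. *)
Lemma cos_frequency_ge k x : `|x| <= 1 -> (2 ^+ k)^-1 <= cos (frequency k * x).
Proof.
move=> x1; have /andP[f0 fp] := frequency_itv k.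
have fx : 0 <= `|frequency k * x| <= frequency k.
  by rewrite normr_ge0 normrM ger0_norm//= ler_piMr.
rewrite -cos_norm; apply: (@le_trans _ _ (cos (frequency k))).
  apply: le_trans (sin_dyadic_ge k) _.
  rewrite -cosBpihalf -cosN (_ : - _ = frequency k)//.
  by rewrite /frequency; ring.
have pp : pi / 2 <= pi :> R by have := pi_ge0 R; lra.
case/andP: fx => fx0 fx1.
have fpi : frequency k <= pi := le_trans fp pp.
rewrite leNgt ltr_cos ?in_itv/=; first by rewrite -leNgt.
- by rewrite f0.
- by rewrite fx0 (le_trans fx1).
Qed.

Lemma cosh_ge x : expR `|x| / 2 <= cosh x.
Proof.
rewrite /cosh ler_pM2r ?invr_gt0//.
by case: ger0P => _; rewrite ?lerDl ?lerDr ?expR_ge0.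
Qed.

Lemma cosh_ge0 x : 0 <= cosh x.
Proof. by rewrite /cosh divr_ge0// addr_ge0// expR_ge0. Qed.

Lemma cosh0 : cosh 0 = 1 :> R.
Proof. by rewrite /cosh oppr0 expR0 -mulr2n divff// pnatr_eq0. Qed.

Lemma dyadic_bracket (a : R) N : 1 <= a -> a < 2 ^+ N ->
  exists2 k, (k < N)%N & 2 ^+ k <= a < 2 ^+ k.+1.
Proof.
move=> a1; elim: N => [|N IH]; first by rewrite expr0 ltNge a1.
have [aN _|Na aS] := ltP a (2 ^+ N); last by exists N; rewrite ?Na.
by have [k kN ka] := IH aN; exists k => //; exact: ltnW.
Qed.

Lemma cmod_le x y : `|x| <= 1 -> cmod (x, y) <= 1 + `|y|.
Proof.
move=> x1; have y0 := normr_ge0 y.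
rewrite -[leRHS]ger0_norm ?addr_ge0// -sqrtr_sqr /cmod/= ler_wsqrtr//.
have x2 : `|x| ^+ 2 <= 1 by rewrite expr_le1.
rewrite -(real_normK (num_real x)) -(real_normK (num_real y)).
by rewrite sqrrD expr1n mul1r; lra.
Qed.

Lemma cmod_ge x y : `|y| <= cmod (x, y).
Proof. by rewrite -sqrtr_sqr /cmod/= ler_wsqrtr// lerDr sqr_ge0. Qed.

(** This identity dictates the ratio 2^(1 - al): the coefficient times the lower bound for the
    cosine is exactly the power weight at 2^k. *)
Lemma powR_dyadic al k :
  (2 `^ (1 - al)) ^+ k * (2 ^+ k)^-1 = ((2 ^+ k) `^ al)^-1 :> R.
Proof.
rewrite -exprVn -exprMn; have -> : 2 `^ (1 - al) * 2^-1 = 2 `^ (- al) :> R.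
  rewrite powRB ?pnatr_eq0 ?implybT// powRr1//.
  by rewrite powRN mulrAC divff ?mul1r// pnatr_eq0.
by rewrite powRN exprVn -!powR_mulrn ?powR_ge0// powRAC.
Qed.

(* The strip function sum_k q^k cosh (l_k y) cos (l_k x) dominates the weight: if
   2^k is comparable to 1 + |y|, its k-th term already does. *)
Lemma weight_le_majorant al x y N : 1 < al -> `|x| <= 1 -> 1 + `|y| < 2 ^+ N ->
  expR (pi / 2 * cmod (x, y)) / (1 + cmod (x, y)) `^ al <=
  2 * expR (3 * (pi / 2)) * \sum_(k < N) (2 `^ (1 - al)) ^+ k *
     (cos (frequency k * x) * cosh (frequency k * y)).
Proof.
move=> al1 x1 yN; have al0 : 0 <= al by lra.
have y0 := normr_ge0 y; have p0 := pihalf_ge0.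
have y1 : 1 <= 1 + `|y| by rewrite lerDl.
have [k kN /andP[ky yk]] := dyadic_bracket y1 yN.
have q0 : 0 <= 2 `^ (1 - al) :> R by exact: powR_ge0.
have c0 j : 0 <= cos (frequency j * x).
  by apply: le_trans (cos_frequency_ge j x1); case/andP: (exp2V_itv j) => /ltW.
pose B := (1 + `|y|) `^ al; pose A := (2 ^+ k : R) `^ al.
have A0 : 0 < A by rewrite powR_gt0// exprn_gt0.
have AB : A <= B.
  by apply: ge0_ler_powR => //; rewrite nnegrE ?addr_ge0// exprn_ge0.
have B0 : 0 < B := lt_le_trans A0 AB.
have cB : B <= (1 + cmod (x, y)) `^ al.
  apply: ge0_ler_powR => //; rewrite ?nnegrE ?addr_ge0// ?sqrtr_ge0//.
  by rewrite lerD2l cmod_ge.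
have T : 2 * expR (3 * (pi / 2)) * ((2 `^ (1 - al)) ^+ k *
    (cos (frequency k * x) * cosh (frequency k * y))) >=
    expR (pi / 2) * expR (pi / 2 * `|y|) / A.
  (* As 2^-k |y| is at most 2, lowering the frequency from pi/2 costs at most a factor exp (2
     pi/2). *)
  have e1 : expR (pi / 2 * `|y|) * expR (- (2 * (pi / 2))) <= expR (frequency k * `|y|).
    rewrite -expRD ler_expR /frequency.
    have : (2 ^+ k)^-1 * `|y| <= 2.
      by rewrite ler_pdivrMl ?exprn_gt0// -exprSr; lra.
    by move=> h; have := ler_wpM2r p0 h; lra.
  have e2 : expR (pi / 2) * expR (pi / 2 * `|y|) <=
      2 * expR (3 * (pi / 2)) * cosh (frequency k * y).
    apply: (@le_trans _ _ (2 * expR (3 * (pi / 2)) * (expR (frequency k * `|y|) / 2))).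
      have -> : 2 * expR (3 * (pi / 2)) * (expR (frequency k * `|y|) / 2) =
        expR (3 * (pi / 2)) * expR (frequency k * `|y|) by field.
      have -> : expR (pi / 2) = expR (3 * (pi / 2)) * expR (- (2 * (pi / 2))) :> R.
        by rewrite -expRD; congr expR; ring.
      by rewrite -mulrA ler_wpM2l ?expR_ge0// mulrC.
    rewrite ler_wpM2l ?mulr_ge0 ?expR_ge0//.
    have /andP[f0 _] := frequency_itv k.
    by have := cosh_ge (frequency k * y); rewrite normrM ger0_norm.
  have -> : 2 * expR (3 * (pi / 2)) * ((2 `^ (1 - al)) ^+ k *
    (cos (frequency k * x) * cosh (frequency k * y))) =
    (2 * expR (3 * (pi / 2)) * cosh (frequency k * y)) *
    ((2 `^ (1 - al)) ^+ k * cos (frequency k * x)) by ring.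
  apply: ler_pM => //; first by rewrite invr_ge0 ltW.
  by rewrite -powR_dyadic ler_wpM2l ?exprn_ge0//; exact: cos_frequency_ge.
(* Bounding the modulus by 1 + |y| costs a further exp (pi/2), which accounts for the exponent 3
   pi/2; the factor 2 comes from the hyperbolic cosine. *)
apply: (@le_trans _ _ (expR (pi / 2) * expR (pi / 2 * `|y|) / A)).
  apply: ler_pM; rewrite ?expR_ge0 ?invr_ge0 ?powR_ge0//.
    by rewrite -expRD ler_expR; have := ler_wpM2l p0 (cmod_le y x1); lra.
  by rewrite lef_pV2 ?posrE// (le_trans AB cB, lt_le_trans B0 cB).
apply: le_trans T _; rewrite ler_wpM2l ?mulr_ge0 ?expR_ge0//.
rewrite (bigD1 (Ordinal kN))//= lerDl sumr_ge0// => j _.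
by rewrite mulr_ge0 ?exprn_ge0// mulr_ge0// cosh_ge0.
Qed.

(** On the real axis the terms are at most those of a geometric series, whose ratio is below 1
    because [al] exceeds 1. The bound is independent of [N]. *)
Lemma majorant_center_le al x N : 1 < al ->
  \sum_(k < N) (2 `^ (1 - al)) ^+ k * (cos (frequency k * x) * cosh (frequency k * 0))
    <= (1 - 2 `^ (1 - al))^-1.
Proof.
move=> al1; set q : R := 2 `^ (1 - al).
have q0 : 0 < q by exact: powR_gt0.
have q1 : q < 1.
  rewrite /q -(opprB al 1) powRN invf_lt1 ?powR_gt0//.
  have : 1 `^ (al - 1) < 2 `^ (al - 1) :> R.
    by apply: gt0_ltr_powR; rewrite ?nnegrE ?subr_gt0 ?ltr1n.
  by rewrite powR1.
apply: (@le_trans _ _ (\sum_(k < N) q ^+ k)).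
  apply: ler_sum => k _.
  by rewrite mulr0 cosh0 mulr1 ler_piMr ?exprn_ge0 ?(ltW q0)// cos_le1.
have := @geometric_le_lim R N 1 q ler01 q0.
rewrite ger0_norm ?(ltW q0)// mul1r => /(_ q1); apply: le_trans.
rewrite /series /= big_mkord; apply: ler_sum => k _.
by rewrite mul1r.
Qed.

End StripMajorant.

(** * The majorant composed with the holomorphic function *)

Section Majorant.
Set Implicit Arguments. Unset Strict Implicit. Unset Printing Implicit Defensive.
Context {R : realType} {n : nat}.
Notation V := ('rV[R]_n * 'rV[R]_n)%type.
Implicit Types (u v : V -> R) (z : V).

Definition majorant (c q : R) N u v z :=
  c * \sum_(k < N) q ^+ k * (cos (frequency k * u z) * cosh (frequency k * v z)).

(** A conjugate [K] common to all points is built term by term; the comparison needs only its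
    existence. *)
Lemma cauchy_riemann_majorant c q N u v : exists K, forall z,
  cauchy_riemann u v z -> cauchy_riemann (majorant c q N u v) K z.
Proof.
suff [K HK] : exists K, forall z, cauchy_riemann u v z -> cauchy_riemann (fun y =>
    \sum_(k < N) q ^+ k * (cos (frequency k * u y) * cosh (frequency k * v y))) K z.
  by exists (fun y => c * K y) => z /HK; exact: cauchy_riemannZ.
elim: N => [|N [K HK]].
  exists (fun=> 0) => z _; under eq_fun do rewrite big_ord0.
  exact: cauchy_riemann0.
eexists => z CR; under eq_fun do rewrite big_ord_recr /=.
by apply: cauchy_riemannD (HK z CR) _; exact/cauchy_riemannZ/cauchy_riemann_cos.
Qed.

Lemma compact_dyadic_bound (A : set V) v : compact A ->
  (forall z, A z -> {for z, continuous v}) ->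
  exists N, forall z, A z -> 1 + `|v z| < 2 ^+ N.
Proof.
move=> cA cv.
have cvA : {within A, continuous v}.
  by apply: continuous_in_subspaceT => z; rewrite inE; exact: cv.
have [M [_ HM]] := compact_bounded (continuous_compact cvA cA).
have [N MN] := exp2_gt (1 + (M + 1)); exists N => z Az.
have /HM/(_ (v z)) : M < M + 1 by lra.
move=> H; apply: le_lt_trans MN; rewrite lerD2l; apply: H.
by exists z.
Qed.

End Majorant.

(** * The uniform bound over all exhaustions *)

Theorem theorem1p5 (R : realType) (n : nat)
    (Om : set ('rV[R]_n * 'rV[R]_n)) (u v : 'rV[R]_n * 'rV[R]_n -> R)
    (z0 : 'rV[R]_n * 'rV[R]_n) :
  domain Om ->
  holomorphic_on Om (fun z => (u z, v z)) ->
  (forall z, Om z -> `|u z| <= 1) ->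
  Om z0 -> v z0 = 0 ->
  forall alpha : R, 1 < alpha ->
  exists C : R, 0 < C /\
    forall (d : Order.disp_t) (T : porderType d)
           (Omt : T -> set ('rV[R]_n * 'rV[R]_n)),
      (* {Omt t} is an exhaustion of Om *)
      (forall t, domain (Omt t) /\ rel_compact (Omt t) Om) ->
      (forall s t, (s <= t)%O -> Omt s `<=` Omt t) ->
      \bigcup_t Omt t = Om ->
      forall t, Omt t z0 ->
        (harm_measure_integral (Omt t) z0
           (fun z => expR (pi / 2 * cmod (u z, v z)) /
                     powR (1 + cmod (u z, v z)) alpha)%R
         <= C%:E)%E.
Proof.
move=> [oOm _] hol u1 Omz0 vz0 al al1.
pose q : R := 2 `^ (1 - al); pose c : R := 2 * expR (3 * (pi / 2)).
have c0 : 0 < c by rewrite mulr_gt0// expR_gt0.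
exists (c * (1 - q)^-1); split.
  (* Positivity of the geometric sum is read off the bound with a single term, which equals 1 since
     [frequency 0] is 0. *)
  rewrite mulr_gt0//; apply: lt_le_trans (majorant_center_le (u z0) 1 al1).
  rewrite big_ord1 expr0 mul1r mulr0 cosh0 mulr1.
  by rewrite /frequency expr0 invr1 subrr !mul0r cos0.
move=> d T Omt exh _ _ t tz0; have [[oD _] rc] := exh t.
have CR z : Om z -> cauchy_riemann u v z.
  exact: cauchy_riemann_holomorphic hol.
have cv z : closure (Omt t) z -> {for z, continuous v}.
  by move=> /rc.2/CR[_ dv _]; exact: differentiable_continuous.
(* The number of terms depends on [t] and on the exhaustion, but the constant chosen above does
   not. *)
have [N vN] := compact_dyadic_bound rc.1 cv.
have [K HK] := cauchy_riemann_majorant c q N u v.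
apply: (@le_trans _ _ (majorant c q N u v z0)%:E).
  apply: (perron_comparison oD oOm rc (fun z Oz => HK z (CR z Oz))) => // p [clp _].
  by apply: weight_le_majorant => //; [exact/u1/rc.2|exact: vN].
rewrite lee_fin /majorant vz0 ler_wpM2l ?(ltW c0)//.
exact: majorant_center_le.
Qed.
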